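(* Let $\mathcal{C}$ be a unitary modular tensor category with spectrum $\Delta=\{[a_0],\dots,[a_n]\}$ (where $[a_0]=[\mathrm{id}]$), fusion multiplicities $N^k_{i,j}$, phases $\omega_i$ and modular matrix $S$. For $i,k\in\{0,\dots,n\}$ let $\tau_{k,i}$ be the trace of the self-braiding of $a_i$ in the channel $a_k$, as defined in the context. Then for every $i,k=0,\dots,n$ $$\tau_{k,i}=\omega_i^{-1}\sum_{r,s=0}^{n}\overline{S_{r,k}}\,S_{s,0}\,N^{i}_{r,s}\,\frac{\omega_s^2}{\omega_r^2}.$$ In particular, for every $i=0,\dots,n$, the Frobenius–Schur indicator $\nu_i:=\omega_i\tau_{0,i}$ satisfies $$\nu_i=\sum_{r,s=0}^{n}S_{r,0}\,S_{s,0}\,N^{i}_{r,s}\,\frac{\omega_r^2}{\omega_s^2}.$$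
   Context: A unitary modular tensor category (UMTC) $\mathcal{C}$ is a strict unitary fusion category (a $C^*$-tensor category with finite-dimensional Hom spaces, finite direct sums, subobjects, conjugates, finitely many isomorphism classes of irreducible objects, and irreducible tensor unit $\mathrm{id}$) equipped with a unitary braiding $\varepsilon_{a,b}\in\mathrm{Hom}_{\mathcal{C}}(a\times b,b\times a)$ which is modular, i.e. the matrix $S$ below is invertible. The tensor product is written $\times$, the adjoint of a morphism $t$ is $t^*$, and $\overline a$ denotes a conjugate (dual) of $a$. The spectrum $\Delta$ is the set of unitary isomorphism classes of irreducible objects, labelled by $0,\dots,n$, with $0$ the class of $\mathrm{id}$; $a_i$ denotes a representative of the $i$-th class, and $N^k_{i,j}=\dim\mathrm{Hom}_{\mathcal{C}}(a_k,a_i\times a_j)$. Dimensions and phases: $d_i>0$ is the intrinsic (quantum) dimension of $a_i$. If $r\in\mathrm{Hom}_{\mathcal C}(\mathrm{id},\overline{a_i}\times a_i)$ is part of a standard solution of the conjugate equations (so $r^*\circ r=d_i$), then the phase $\omega_i$ is defined by $(r^*\times 1_{a_i})\circ(1_{\overline{a_i}}\times\varepsilon_{a_i,a_i})\circ(r\times 1_{a_i})=\omega_i 1_{a_i}$. With these conventions the monodromy $\varepsilon_{a_j,a_i}\circ\varepsilon_{a_i,a_j}$ acts on $\mathrm{Hom}_{\mathcal{C}}(a_k,a_i\times a_j)$ (by left composition) as the scalar $\omega_k/(\omega_i\omega_j)$. Modular matrices: put $Y_{i,j}=\sum_k N^k_{i,j}\frac{\omega_i\omega_j}{\omega_k}d_k$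 and $\sigma=\sum_i d_i^2\omega_i^{-1}$ (so $|\sigma|=(\sum_i d_i^2)^{1/2}$ by modularity). Then $S_{i,j}=|\sigma|^{-1}Y_{i,j}$ and $T_{i,j}=(\sigma/|\sigma|)^{1/3}\omega_i\delta_{i,j}$. They satisfy $(ST)^3=S^2=C$, where $C_{i,j}=\delta_{i,\overline{j}}$ is the conjugation matrix. In particular $d_i=S_{0,i}/S_{0,0}$ and $\omega_i=T_{i,i}/T_{0,0}$. Trace of the self-braiding: for $i,k\in\{0,\dots,n\}$ let $m=N^k_{i,i}$. If $m>0$, choose a linear basis $t^1_k,\dots,t^m_k$ of $\mathrm{Hom}_{\mathcal{C}}(a_k,a_i\times a_i)$ consisting of orthonormal isometries, $(t^e_k)^*\circ t^{e'}_k=\delta_{e,e'}1_{a_k}$, and set $$\tau_{k,i}:=\sum_{e=1}^m(t^e_k)^*\circ\varepsilon_{a_i,a_i}\circ t^e_k\in\mathrm{Hom}_{\mathcal C}(a_k,a_k)=\mathbb{C}1_{a_k},$$ regarded as a complex number. If $m=0$, set $\tau_{k,i}:=0$. This number does not depend on the choice of representatives or of basis. *)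

(* Defs.v *)
(* Unitary modular tensor categories over the MathComp libraries; the complex
   numbers are R[i] for R : realType. *)
From mathcomp Require Import all_boot all_order all_algebra complex.
From mathcomp Require Import boolp classical_sets reals.

Set Implicit Arguments.
Unset Strict Implicit.
Unset Printing Implicit Defensive.

Import Order.TTheory GRing.Theory Num.Theory.
Local Open Scope ring_scope.

(* The Hom spaces are finite-dimensional, hence complete for any norm, so there
   is no completeness axiom.  The last axiom says that f^* f is a positive
   element of the C*-algebra End(a). *)
Record cstar_category (R : realType) : Type := CStarCategory {
  obj :> Type;
  Hom : obj -> obj -> vectType R[i];
  idm : forall a, Hom a a;
  comp : forall a b c, Hom b c -> Hom a b -> Hom a c;
  star : forall a b, Hom a b -> Hom b a;
  hnorm : forall a b, Hom a b -> R;

  compA : forall a b c d (h : Hom c d) (g : Hom b c) (f : Hom a b),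
    comp h (comp g f) = comp (comp h g) f;
  comp1m : forall a b (f : Hom a b), comp (idm b) f = f;
  compm1 : forall a b (f : Hom a b), comp f (idm a) = f;
  compDl : forall a b c (z : R[i]) (g g' : Hom b c) (f : Hom a b),
    comp (z *: g + g') f = z *: comp g f + comp g' f;
  compDr : forall a b c (z : R[i]) (g : Hom b c) (f f' : Hom a b),
    comp g (z *: f + f') = z *: comp g f + comp g f';

  starK : forall a b (f : Hom a b), star (star f) = f;
  star_comp : forall a b c (g : Hom b c) (f : Hom a b),
    star (comp g f) = comp (star f) (star g);
  star_antilinear : forall a b (z : R[i]) (f f' : Hom a b),
    star (z *: f + f') = z^* *: star f + star f';

  hnorm_eq0 : forall a b (f : Hom a b), hnorm f = 0 -> f = 0;
  hnormD : forall a b (f f' : Hom a b), hnorm (f + f') <= hnorm f + hnorm f';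
  hnormZ : forall a b (z : R[i]) (f : Hom a b),
    hnorm (z *: f) = ComplexField.Normc.normc z * hnorm f;
  hnorm_comp : forall a b c (g : Hom b c) (f : Hom a b),
    hnorm (comp g f) <= hnorm g * hnorm f;
  hnorm_cstar : forall a b (f : Hom a b),
    hnorm (comp (star f) f) = hnorm f ^+ 2;
  star_comp_pos : forall a b (f : Hom a b),
    exists s : Hom a a, comp (star f) f = comp (star s) s
}.

Declare Scope umtc_scope.
Delimit Scope umtc_scope with U.
Local Open Scope umtc_scope.

Notation "g \oc f" := (comp g f) (at level 40, left associativity) : umtc_scope.
Notation "f ^#" := (star f) (at level 2, format "f ^#") : umtc_scope.

Section CStar.
Variables (R : realType) (C : cstar_category R).

Definition isometry (a b : C) (v : Hom a b) : Prop := v^# \oc v = idm a.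

Definition unitary (a b : C) (u : Hom a b) : Prop :=
  u^# \oc u = idm a /\ u \oc u^# = idm b.

Definition uequiv (a b : C) : Prop := exists u : Hom a b, unitary u.

Definition projection (a : C) (p : Hom a a) : Prop :=
  p \oc p = p /\ p^# = p.

(* End(a) = C 1_a, where 1_a <> 0 *)
Definition irreducible (a : C) : Prop :=
  idm a <> 0 /\ forall f : Hom a a, exists z : R[i], f = z *: idm a.

(* The identity morphism, seen as a morphism between two objects that are
   provably (but not definitionally) equal. *)
Definition eqm (a b : C) (e : a = b) : Hom a b := ecast x (Hom a x) e (idm a).

End CStar.

(* Strictness is equality of objects, together with the same equalities for
   morphisms up to transport by [eqm]. *)
Record strict_tensor_category (R : realType) : Type := StrictTensorCategory {
  stc_category :> cstar_category R;
  one : stc_category;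
  tens : stc_category -> stc_category -> stc_category;
  tensm : forall a a' b b' : stc_category,
    Hom a a' -> Hom b b' -> Hom (tens a b) (tens a' b');

  tensA : forall a b c, tens a (tens b c) = tens (tens a b) c;
  ten1o : forall a, tens one a = a;
  teno1 : forall a, tens a one = a;

  tensm1 : forall a b, tensm (idm a) (idm b) = idm (tens a b);
  tensm_comp : forall a a' a'' b b' b'' (f' : Hom a' a'') (f : Hom a a')
      (g' : Hom b' b'') (g : Hom b b'),
    tensm (f' \oc f) (g' \oc g) = tensm f' g' \oc tensm f g;
  tensmDl : forall a a' b b' (z : R[i]) (f f' : Hom a a') (g : Hom b b'),
    tensm (z *: f + f') g = z *: tensm f g + tensm f' g;
  tensmDr : forall a a' b b' (z : R[i]) (f : Hom a a') (g g' : Hom b b'),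
    tensm f (z *: g + g') = z *: tensm f g + tensm f g';
  tensm_star : forall a a' b b' (f : Hom a a') (g : Hom b b'),
    (tensm f g)^# = tensm f^# g^#;

  tensmA : forall a a' b b' c c' (f : Hom a a') (g : Hom b b') (h : Hom c c'),
    eqm (tensA a' b' c') \oc tensm f (tensm g h)
    = tensm (tensm f g) h \oc eqm (tensA a b c);
  ten1m : forall a a' (f : Hom a a'),
    eqm (ten1o a') \oc tensm (idm one) f = f \oc eqm (ten1o a);
  tenm1 : forall a a' (f : Hom a a'),
    eqm (teno1 a') \oc tensm f (idm one) = f \oc eqm (teno1 a)
}.

Arguments one {R s}.

Notation "a \ox b" := (tens a b) (at level 38, left associativity) : umtc_scope.
Notation "f \xm g" := (tensm f g) (at level 38, left associativity) : umtc_scope.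
Notation "1_ a" := (idm a) (at level 8, a at level 2, format "1_ a") : umtc_scope.

Section Tensor.
Variables (R : realType) (C : strict_tensor_category R).

Definition assocm (a b c : C) : Hom (a \ox (b \ox c)) (a \ox b \ox c) :=
  eqm (tensA a b c).
Definition assocV (a b c : C) : Hom (a \ox b \ox c) (a \ox (b \ox c)) :=
  eqm (esym (tensA a b c)).
Definition lunit (a : C) : Hom (one \ox a) a := eqm (ten1o a).
Definition lunitV (a : C) : Hom a (one \ox a) := eqm (esym (ten1o a)).
Definition runitV (a : C) : Hom a (a \ox one) := eqm (esym (teno1 a)).

(* (rb^* x 1_a) o (1_a x r) = 1_a  and  (r^* x 1_ab) o (1_ab x rb) = 1_ab *)
Definition conjugate_eqs (a ab : C) (r : Hom one (ab \ox a))
    (rb : Hom one (a \ox ab)) : Prop :=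
  lunit a \oc (rb^# \xm 1_a) \oc assocm a ab a \oc (1_a \xm r) \oc runitV a
    = 1_a
  /\
  lunit ab \oc (r^# \xm 1_ab) \oc assocm ab a ab \oc (1_ab \xm rb) \oc runitV ab
    = 1_ab.

(* For irreducible a, the only case in which this is used, the standard
   solutions are exactly the normalized ones. *)
Definition standard_solution (a ab : C) (r : Hom one (ab \ox a))
    (rb : Hom one (a \ox ab)) : Prop :=
  conjugate_eqs r rb /\ r^# \oc r = rb^# \oc rb.

Definition qdim (a : C) : R[i] :=
  xget 0 [set d : R[i] | exists (ab : C) (r : Hom one (ab \ox a))
      (rb : Hom one (a \ox ab)),
    standard_solution r rb /\ r^# \oc r = d *: 1_one]%classic.

End Tensor.

Record unitary_fusion_category (R : realType) : Type := UnitaryFusionCategory {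
  ufc_category :> strict_tensor_category R;
  one_irreducible : irreducible (one : ufc_category);
  direct_sums : forall a b : ufc_category,
    exists (c : ufc_category) (u : Hom a c) (v : Hom b c),
      [/\ isometry u, isometry v & u \oc u^# + v \oc v^# = 1_c];
  (* p = 0 is excluded: a zero object is allowed but not required. *)
  subobjects : forall (a : ufc_category) (p : Hom a a),
    projection p -> p <> 0 ->
    exists (b : ufc_category) (v : Hom b a), isometry v /\ v \oc v^# = p;
  conjugates : forall a : ufc_category,
    exists (ab : ufc_category) (r : Hom one (ab \ox a))
      (rb : Hom one (a \ox ab)), conjugate_eqs r rb;
  finitely_many_irreducibles :
    exists (m : nat) (x : 'I_m -> ufc_category),
      forall a : ufc_category, irreducible a -> exists i, uequiv a (x i)
}.

Record braiding (R : realType) (C : strict_tensor_category R) : Type := Braiding {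
  braid :> forall a b : C, Hom (a \ox b) (b \ox a);
  braid_unitary : forall a b, unitary (braid a b);
  braid_natural : forall (a a' b b' : C) (f : Hom a a') (g : Hom b b'),
    braid a' b' \oc (f \xm g) = (g \xm f) \oc braid a b;
  braid_tensr : forall a b c,
    braid a (b \ox c) =
    assocm b c a \oc (1_b \xm braid a c) \oc assocV b a c
      \oc (braid a b \xm 1_c) \oc assocm a b c;
  braid_tensl : forall a b c,
    braid (a \ox b) c =
    assocV c a b \oc (braid a c \xm 1_b) \oc assocm a c b
      \oc (1_a \xm braid b c) \oc assocV a b c
}.

(* The number w with
   (r^* x 1_a) o (1_ab x braid_{a,a}) o (r x 1_a) = w 1_a. *)
Definition phase (R : realType) (C : strict_tensor_category R) (E : braiding C)
    (a : C) : R[i] :=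
  xget 0 [set w : R[i] | exists (ab : C) (r : Hom one (ab \ox a))
      (rb : Hom one (a \ox ab)),
    standard_solution r rb /\
    lunit a \oc (r^# \xm 1_a) \oc assocm ab a a \oc (1_ab \xm E a a)
      \oc assocV ab a a \oc (r \xm 1_a) \oc lunitV a = w *: 1_a]%classic.

(* A labelling of the spectrum by 0, ..., n with a choice of representatives. *)
Record spectrum (R : realType) (C : strict_tensor_category R) : Type := Spectrum {
  spec_n : nat;
  rep :> 'I_spec_n.+1 -> C;
  rep_irreducible : forall i, irreducible (rep i);
  rep_one : uequiv (rep ord0) one;
  rep_inj : forall i j, uequiv (rep i) (rep j) -> i = j;
  rep_surj : forall a : C, irreducible a -> exists i, uequiv a (rep i)
}.

Section ModularData.
Variables (R : realType) (C : strict_tensor_category R).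
Variables (E : braiding C) (D : spectrum C).
Local Notation n := (spec_n D).
Implicit Types i j k : 'I_n.+1.

Definition fusion_mult i j k : nat := \dim {:Hom (D k) (D i \ox D j)}.

Definition dimD i : R[i] := qdim (D i).

Definition omega i : R[i] := phase E (D i).

Definition Ymx : 'M[R[i]]_n.+1 :=
  \matrix_(i, j) \sum_k
    (fusion_mult i j k)%:R * (omega i * omega j / omega k) * dimD k.

Definition sigma : R[i] := \sum_i dimD i ^+ 2 * (omega i)^-1.

Definition Smx : 'M[R[i]]_n.+1 := `|sigma|^-1 *: Ymx.

Definition orthonormal_basis (a b : C) (m : nat) (t : m.-tuple (Hom a b)) : Prop :=
  basis_of {:Hom a b} t /\
  forall e e', (tnth t e)^# \oc tnth t e' = (e == e')%:R *: 1_a.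

(* For fusion_mult i i k = 0 the sum is empty and the value is 0. *)
Definition self_braiding_trace k i : R[i] :=
  xget 0 [set z : R[i] |
    exists t : (fusion_mult i i k).-tuple (Hom (D k) (D i \ox D i)),
      orthonormal_basis t /\
      \sum_e (tnth t e)^# \oc E (D i) (D i) \oc tnth t e = z *: 1_(D k)]%classic.

Definition FS_indicator i : R[i] := omega i * self_braiding_trace ord0 i.

End ModularData.

(* Invertibility of S does not depend on the labelling and representatives. *)
Definition modular (R : realType) (C : strict_tensor_category R)
    (E : braiding C) : Prop :=
  forall D : spectrum C, Smx E D \in unitmx.

Record umtc (R : realType) : Type := UMTC {
  umtc_category :> unitary_fusion_category R;
  umtc_braiding : braiding umtc_category;
  umtc_modular : modular umtc_braiding
}.

(* Main.v *)
From HB Require Import structures.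
From mathcomp Require Import all_boot all_order all_algebra complex.
From mathcomp Require Import ring spectral.
From mathcomp Require Import boolp classical_sets reals.
Require Import Defs.

Set Implicit Arguments.
Unset Strict Implicit.
Unset Printing Implicit Defensive.

Import Order.TTheory GRing.Theory Num.Theory.
Local Open Scope ring_scope.
Local Open Scope umtc_scope.

(** Write [w_i], [d_i] for the phases and dimensions, [N] for the fusion
    multiplicities, and [X_ij] for the trace of the monodromy of [a_i] and
    [a_j].  Since the monodromy acts on [Hom(a_k, a_i a_j)] by
    [w_k / (w_i w_j)], the number [X_ij] is the complex conjugate of [Y_ij].

    The heart of the proof is an identity of braids.  Consider three strands
    [a_i, a_i, a_l], and let [a_l] run around the two strands [a_i], which then
    cross each other once.  With [s1], [s2] the generators of the braid group,
    this is

      s1 s2 s1 s1 s2 = s2 s2 s1 s2 s2.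

    Close all the strands.  On the left, decompose [a_i a_i] into irreducible
    channels: the crossing contributes [tau_{k,i}] and the loop of [a_l]
    contributes [X_kl].  On the right, close the first strand [a_i] only: the
    crossing in the middle becomes the phase [w_i], and what is left is the
    square of the monodromy of [a_i] and [a_l].  Thus
    ([self_braiding_trace_sum])

      sum_k tau_{k,i} X_kl = w_i sum_s N_{il}^s (w_s / (w_i w_l))^2 d_s,

    and the formula follows by inverting the matrix [X].  For this one needs
    that [S] is unitary, while the hypothesis is only that it is invertible.
    The columns of [X] are eigenvectors of the fusion matrices
    ([mono_trace_char]), and the fusion matrix of the conjugate of [a_i] is the
    transpose of the one of [a_i] ([fusion_mult_bar]); so distinct columns are
    orthogonal.  Because [X] is symmetric and its first column has no zero
    entry, all columns have the same norm, which is [|sigma|] by a Gauss sum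
    computation ([trace_inversion]).

    Two points of the theory of C*-tensor categories carry the trace
    computations.  The first is that the double partial trace over [a b] of a
    morphism that factors through an irreducible [k] is the trace over [k]
    ([ltr2_fus]), and that the monodromy is the scalar [w_k / (w_a w_b)] on
    [Hom(k, a b)] ([mono_fus]).  Both come from one argument: computing the
    phase of the product [a b] in two ways shows that, on [Hom(k, a b)], the
    unitary operator given by [w_a w_b / w_k] times the monodromy is represented
    by a Gram matrix, hence is positive; a positive unitary operator is the
    identity, so the Gram matrix is trivial as well.  The second is
    semisimplicity ([completeness]), which rests on the existence of minimal
    projections in a finite-dimensional C*-algebra ([minimal_projection]).

    Diagrams are read as morphisms between words [a (b (c x))] bracketed to the
    right, with an arbitrary object [x] at their right end.  Tensoring on the
    left with an identity is then the only tensor operation on morphisms, and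
    the identifications of objects that express strictness never appear after
    the basic lemmas on [fus], [cup] and [beta]. *)
(** * Linear algebra in a C*-category *)

Section CStarBasics.
Variables (R : realType) (C : cstar_category R).
Implicit Types a b c : C.

Lemma comp0l a b c (f : Hom a b) : (0 : Hom b c) \oc f = 0.
Proof. by have := compDl (-1) 0 (0 : Hom b c) f; rewrite scaler0 addr0 scaleN1r addNr. Qed.

Lemma comp0r a b c (g : Hom b c) : g \oc (0 : Hom a b) = 0.
Proof. by have := compDr (-1) g 0 (0 : Hom a b); rewrite scaler0 addr0 scaleN1r addNr. Qed.

Lemma compZl a b c z (g : Hom b c) (f : Hom a b) : (z *: g) \oc f = z *: (g \oc f).
Proof. by have := compDl z g 0 f; rewrite !addr0 comp0l addr0. Qed.

Lemma compZr a b c z (g : Hom b c) (f : Hom a b) : g \oc (z *: f) = z *: (g \oc f).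
Proof. by have := compDr z g f 0; rewrite !addr0 comp0r addr0. Qed.

Lemma compDl1 a b c (g g' : Hom b c) (f : Hom a b) :
  (g + g') \oc f = g \oc f + g' \oc f.
Proof. by have := compDl 1 g g' f; rewrite !scale1r. Qed.

Lemma compDr1 a b c (g : Hom b c) (f f' : Hom a b) :
  g \oc (f + f') = g \oc f + g \oc f'.
Proof. by have := compDr 1 g f f'; rewrite !scale1r. Qed.

Lemma compBl a b c (g g' : Hom b c) (f : Hom a b) :
  (g - g') \oc f = g \oc f - g' \oc f.
Proof. by rewrite compDl1 -scaleN1r compZl scaleN1r. Qed.

Lemma compBr a b c (g : Hom b c) (f f' : Hom a b) :
  g \oc (f - f') = g \oc f - g \oc f'.
Proof. by rewrite compDr1 -(scaleN1r f') compZr scaleN1r. Qed.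

Lemma comp_suml a b c (I : Type) (s : seq I) (P : pred I) (F : I -> Hom b c)
    (f : Hom a b) :
  (\sum_(i <- s | P i) F i) \oc f = \sum_(i <- s | P i) (F i \oc f).
Proof.
by apply: (big_morph (fun g => g \oc f)) => [g g'|]; rewrite ?compDl1 ?comp0l.
Qed.

Lemma comp_sumr a b c (I : Type) (s : seq I) (P : pred I) (F : I -> Hom a b)
    (g : Hom b c) :
  g \oc (\sum_(i <- s | P i) F i) = \sum_(i <- s | P i) (g \oc F i).
Proof.
by apply: (big_morph (fun f => g \oc f)) => [f f'|]; rewrite ?compDr1 ?comp0r.
Qed.

Lemma star0 a b : (0 : Hom a b)^# = 0.
Proof.
have := star_antilinear (-1) 0 (0 : Hom a b).
by rewrite scaler0 addr0 rmorphN rmorph1 scaleN1r addNr.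
Qed.

Lemma starZ a b z (f : Hom a b) : (z *: f)^# = z^* *: f^#.
Proof. by have := star_antilinear z f 0; rewrite addr0 star0 addr0. Qed.

Lemma starD a b (f f' : Hom a b) : (f + f')^# = f^# + f'^#.
Proof. by have := star_antilinear 1 f f'; rewrite rmorph1 !scale1r. Qed.

Lemma starB a b (f f' : Hom a b) : (f - f')^# = f^# - f'^#.
Proof. by rewrite starD -(scaleN1r f') starZ rmorphN rmorph1 scaleN1r. Qed.

Lemma star_sum a b (I : Type) (s : seq I) (P : pred I) (F : I -> Hom a b) :
  (\sum_(i <- s | P i) F i)^# = \sum_(i <- s | P i) (F i)^#.
Proof.
by apply: (big_morph (fun f => f^#)) => [f f'|]; rewrite ?starD ?star0.
Qed.

Lemma star1 a : (idm a)^# = idm a.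
Proof. by rewrite -[LHS]compm1 -{2}[idm a]starK -star_comp compm1 starK. Qed.

Lemma star_inj a b : injective (fun f : Hom a b => f^#).
Proof. by move=> f g /(congr1 (fun h => h^#)); rewrite !starK. Qed.

(** Rewriting two, or three, consecutive factors of a composite that is
    associated to the left. *)
Lemma comp_chain2 a b c d (h : Hom c d) (g : Hom b c) (f : Hom a b) (k : Hom a c) :
  g \oc f = k -> h \oc g \oc f = h \oc k.
Proof. by move<-; rewrite compA. Qed.

Lemma comp_chain3 a b c d e (h : Hom d e) (g : Hom c d) (f : Hom b c) (f' : Hom a b)
    (k : Hom a d) :
  g \oc f \oc f' = k -> h \oc g \oc f \oc f' = h \oc k.
Proof. by move<-; rewrite !compA. Qed.

Lemma cstar_eq0 a b (f : Hom a b) : f^# \oc f = 0 -> f = 0.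
Proof.
move=> f0; apply: hnorm_eq0; apply/eqP; rewrite -sqrf_eq0 -hnorm_cstar f0.
by rewrite -(scale0r (0 : Hom a a)) hnormZ ComplexField.Normc.normc0 mul0r.
Qed.

Lemma cstar_eq0' a b (f : Hom a b) : f \oc f^# = 0 -> f = 0.
Proof.
by move=> f0; rewrite -[f]starK (@cstar_eq0 _ _ f^#) ?starK ?star0.
Qed.

Lemma scal_inj a (z z' : R[i]) : idm a <> 0 -> z *: idm a = z' *: idm a -> z = z'.
Proof.
move=> /eqP a0 /eqP; rewrite -subr_eq0 -scalerBl scaler_eq0 (negPf a0) orbF.
by rewrite subr_eq0 => /eqP.
Qed.

(** The scalar [f^# f] is positive, since [f^# f = s^# s] with [s] a scalar. *)
Lemma irr_pos a b (f : Hom a b) z : irreducible a -> f^# \oc f = z *: idm a -> 0 <= z.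
Proof.
move=> [a0 irr]; have [s ->] := star_comp_pos f; have [w ->] := irr s.
rewrite starZ star1 compZl compZr compm1 scalerA => /(scal_inj a0) <-.
by rewrite mulrC -normCK exprn_ge0.
Qed.

Lemma irr_gt0 a b (f : Hom a b) z :
  irreducible a -> f^# \oc f = z *: idm a -> f <> 0 -> 0 < z.
Proof.
move=> irr fz f0; rewrite lt_neqAle (irr_pos irr fz) andbT eq_sym.
by apply/eqP => z0; apply: f0; apply: cstar_eq0; rewrite fz z0 scale0r.
Qed.

Lemma unitary_comp a b c (u : Hom b c) (v : Hom a b) :
  unitary u -> unitary v -> unitary (u \oc v).
Proof.
move=> [u1 u2] [v1 v2]; split; rewrite star_comp.
  by rewrite compA (comp_chain2 _ u1) compm1 v1.
by rewrite compA (comp_chain2 _ v2) compm1 u2.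
Qed.

End CStarBasics.

(** * Coherence of the identifications of objects *)

Section Coherence.
Variables (R : realType) (C : strict_tensor_category R).
Implicit Types a b c d x y : C.

(** A morphism together with its source and target.  Equality of packed
    morphisms is equality up to the identifications [eqm], and tensor products
    of packed morphisms are strictly associative. *)
Definition pack a b (f : Hom a b) : {a : C & {b : C & Hom a b}} :=
  existT _ a (existT _ b f).

Lemma eqm_id a (e : a = a) : eqm e = idm a.
Proof. by rewrite (Prop_irrelevance e erefl). Qed.

(** By proof irrelevance, an identification of an object with itself is the
    identity. *)
Lemma pack_inj a b (f g : Hom a b) : pack f = pack g -> f = g.
Proof.
have gen a' b' (f' : Hom a' b') : pack f = pack f' ->
    exists (ea : a = a') (eb : b = b'), eqm eb \oc f = f' \oc eqm ea.
  move=> E; pose P (m : {a : C & {b : C & Hom a b}}) :=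
    exists (ea : a = projT1 m) (eb : b = projT1 (projT2 m)),
      eqm eb \oc f = projT2 (projT2 m) \oc eqm ea.
  rewrite -[ex _]/(P (pack f')) -E; exists erefl, erefl.
  by rewrite comp1m compm1.
by move=> /gen [ea [eb]]; rewrite !eqm_id comp1m compm1.
Qed.

Lemma pack_cast (F : C -> C) (G : C -> C) (f : forall x, Hom (F x) (G x)) x y :
  x = y -> pack (f x) = pack (f y).
Proof. by move->. Qed.

Lemma pack_eqm a b (e : a = b) : pack (eqm e) = pack (idm a).
Proof. by case: _ / e. Qed.

Lemma eqmK a b (e : a = b) (e' : b = a) : eqm e' \oc eqm e = idm a.
Proof. by case: _ / e e' => e'; rewrite !eqm_id compm1. Qed.

Lemma eqm_star a b (e : a = b) : (eqm e)^# = eqm (esym e).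
Proof. by case: _ / e; rewrite !eqm_id star1. Qed.

Lemma unitary_eqm a b (e : a = b) : unitary (eqm e : Hom a b).
Proof. by split; rewrite eqm_star eqmK. Qed.

Lemma eqm_tens a b c d (e : a = b) (e' : c = d) :
  eqm e \xm eqm e' = eqm (congr2 (@tens R C) e e').
Proof. by case: _ / e; case: _ / e'; rewrite !eqm_id tensm1. Qed.

Lemma pack_el a b b' (e : b = b') (f : Hom a b) : pack (eqm e \oc f) = pack f.
Proof. by case: _ / e; rewrite comp1m. Qed.

Lemma pack_er a' a b (e : a' = a) (f : Hom a b) : pack (f \oc eqm e) = pack f.
Proof. by case: _ / e f => f; rewrite compm1. Qed.

(** Composition of packed morphisms, with a meaningless value when the target
    of the second does not match the source of the first. *)
Definition pcomp (m n : {a : C & {b : C & Hom a b}}) : {a : C & {b : C & Hom a b}} :=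
  match pselect (projT1 (projT2 n) = projT1 m) with
  | left e => pack (projT2 (projT2 m) \oc eqm e \oc projT2 (projT2 n))
  | right _ => n
  end.

(** Tensor product and adjoint of packed morphisms. *)
Definition ptens (m n : {a : C & {b : C & Hom a b}}) : {a : C & {b : C & Hom a b}} :=
  pack (projT2 (projT2 m) \xm projT2 (projT2 n)).

Definition pstar (m : {a : C & {b : C & Hom a b}}) : {a : C & {b : C & Hom a b}} :=
  pack (projT2 (projT2 m))^#.

Lemma pack_star a b (f : Hom a b) : pack f^# = pstar (pack f).
Proof. by []. Qed.

Lemma pack_comp a b c (g : Hom b c) (f : Hom a b) :
  pack (g \oc f) = pcomp (pack g) (pack f).
Proof.
rewrite /pcomp; case: pselect => [/= e|] //.
by rewrite eqm_id compm1.
Qed.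

Lemma pack_tens a b c d (f : Hom a b) (g : Hom c d) :
  pack (f \xm g) = ptens (pack f) (pack g).
Proof. by []. Qed.

Lemma ptensA m n p : ptens m (ptens n p) = ptens (ptens m n) p.
Proof.
case: m => a [b f]; case: n => c [d g]; case: p => x [y h].
rewrite /ptens /=; have := congr1 (@pack _ _) (tensmA f g h).
by rewrite pack_el pack_er.
Qed.

Lemma ptens1m m : ptens (pack (idm one)) m = m.
Proof.
case: m => a [b f]; rewrite /ptens /=.
by have := congr1 (@pack _ _) (ten1m f); rewrite pack_el pack_er.
Qed.

Lemma ptensm1 m : ptens m (pack (idm one)) = m.
Proof.
case: m => a [b f]; rewrite /ptens /=.
by have := congr1 (@pack _ _) (tenm1 f); rewrite pack_el pack_er.
Qed.

Lemma pack_idtens a b : pack (idm (a \ox b)) = ptens (pack (idm a)) (pack (idm b)).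
Proof. by rewrite -pack_tens tensm1. Qed.

Lemma tensm_eqml a b c (e : a = b) : eqm e \xm idm c = eqm (congr2 (@tens R C) e (erefl c)).
Proof. exact: (eqm_tens e (erefl c)). Qed.

Lemma tensm_eqmr a b c (e : a = b) : idm c \xm eqm e = eqm (congr2 (@tens R C) (erefl c) e).
Proof. exact: (eqm_tens (erefl c) e). Qed.

(** Computes a packed composite; the identifications are erased. *)
Definition packE := (pack_el, pack_er, pack_comp, pack_tens, pack_idtens).

End Coherence.

(** * Diagrams with an arbitrary object to their right *)

Notation "a |> f" := (tensm (idm a) f) (at level 36, right associativity) : umtc_scope.

(** A morphism [t : k -> a b] acting on the first factor of [k x].  This and the
    next definitions are locked so that rewriting with associativity does not
    look inside them. *)
HB.lock Definition fus (R : realType) (C : strict_tensor_category R) (k a b : C)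
    (t : Hom k (a \ox b)) (x : C) : Hom (k \ox x) (a \ox (b \ox x)) :=
  assocV a b x \oc (t \xm idm x).

(** A morphism [p : one -> a b] inserted in front of [x]; for [p] part of a
    solution of the conjugate equations, this is a cup. *)
HB.lock Definition cup (R : realType) (C : strict_tensor_category R) (a b : C)
    (p : Hom one (a \ox b)) (x : C) : Hom x (a \ox (b \ox x)) :=
  fus p x \oc lunitV x.

(** The braiding of the first two factors of [a (b x)]. *)
HB.lock Definition beta (R : realType) (C : strict_tensor_category R) (E : braiding C)
    (a b x : C) : Hom (a \ox (b \ox x)) (b \ox (a \ox x)) :=
  assocV b a x \oc (E a b \xm idm x) \oc assocm a b x.

(** Left partial trace over [a], with respect to [r : one -> ab a]. *)
HB.lock Definition ltr (R : realType) (C : strict_tensor_category R) (a ab : C)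
    (r : Hom one (ab \ox a)) (x y : C) (f : Hom (a \ox x) (a \ox y)) : Hom x y :=
  (cup r y)^# \oc (ab |> f) \oc cup r x.

Section Tails.
Variables (R : realType) (C : strict_tensor_category R).
Implicit Types a b c d k x y : C.

Lemma wcomp a b c d (g : Hom c d) (f : Hom b c) : a |> (g \oc f) = (a |> g) \oc (a |> f).
Proof. by rewrite -tensm_comp compm1. Qed.

Lemma wcompl a b c d (g : Hom c d) (f : Hom b c) :
  (g \oc f) \xm idm a = (g \xm idm a) \oc (f \xm idm a).
Proof. by rewrite -tensm_comp compm1. Qed.

Lemma wstar a b c (f : Hom b c) : (a |> f)^# = a |> f^#.
Proof. by rewrite tensm_star star1. Qed.

Lemma wstarl a b c (f : Hom b c) : (f \xm idm a)^# = f^# \xm idm a.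
Proof. by rewrite tensm_star star1. Qed.

Lemma tensm0r a a' b b' (f : Hom a a') : f \xm (0 : Hom b b') = 0.
Proof. by have := tensmDr (-1) f 0 (0 : Hom b b'); rewrite scaler0 addr0 scaleN1r addNr. Qed.

Lemma tensm0l a a' b b' (g : Hom b b') : (0 : Hom a a') \xm g = 0.
Proof. by have := tensmDl (-1) 0 (0 : Hom a a') g; rewrite scaler0 addr0 scaleN1r addNr. Qed.

Lemma tensmZr a a' b b' z (f : Hom a a') (g : Hom b b') : f \xm (z *: g) = z *: (f \xm g).
Proof. by have := tensmDr z f g 0; rewrite !addr0 tensm0r addr0. Qed.

Lemma tensmZl a a' b b' z (f : Hom a a') (g : Hom b b') : (z *: f) \xm g = z *: (f \xm g).
Proof. by have := tensmDl z f 0 g; rewrite !addr0 tensm0l addr0. Qed.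

Lemma tensmD1r a a' b b' (f : Hom a a') (g g' : Hom b b') :
  f \xm (g + g') = f \xm g + f \xm g'.
Proof. by have := tensmDr 1 f g g'; rewrite !scale1r. Qed.

Lemma tensmD1l a a' b b' (f f' : Hom a a') (g : Hom b b') :
  (f + f') \xm g = f \xm g + f' \xm g.
Proof. by have := tensmDl 1 f f' g; rewrite !scale1r. Qed.

Lemma tensm_sumr a a' b b' (I : Type) (s : seq I) (P : pred I) (f : Hom a a')
    (F : I -> Hom b b') :
  f \xm (\sum_(i <- s | P i) F i) = \sum_(i <- s | P i) f \xm F i.
Proof.
by apply: (big_morph (fun g => f \xm g)) => [g g'|]; rewrite ?tensmD1r ?tensm0r.
Qed.

Lemma tensm_suml a a' b b' (I : Type) (s : seq I) (P : pred I) (F : I -> Hom a a')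
    (g : Hom b b') :
  (\sum_(i <- s | P i) F i) \xm g = \sum_(i <- s | P i) F i \xm g.
Proof.
by apply: (big_morph (fun f => f \xm g)) => [f f'|]; rewrite ?tensmD1l ?tensm0l.
Qed.

Lemma fus_nat k a b (t : Hom k (a \ox b)) x y (f : Hom x y) :
  fus t y \oc (k |> f) = (a |> b |> f) \oc fus t x.
Proof.
rewrite !fus.unlock -compA -tensm_comp comp1m compm1.
apply: pack_inj; rewrite /assocV !packE ptensA -pack_idtens -!pack_tens.
rewrite <- pack_comp.
by rewrite -tensm_comp comp1m compm1.
Qed.

Lemma cup_nat a b (p : Hom one (a \ox b)) x y (f : Hom x y) :
  cup p y \oc f = (a |> b |> f) \oc cup p x.
Proof.
rewrite !cup.unlock compA -fus_nat -!compA; congr (_ \oc _).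
by apply: pack_inj; rewrite /lunitV !packE ptens1m.
Qed.

Lemma fus_star_nat k a b (t : Hom k (a \ox b)) x y (f : Hom x y) :
  (k |> f) \oc (fus t x)^# = (fus t y)^# \oc (a |> b |> f).
Proof.
by apply: star_inj; rewrite !star_comp !starK !wstar fus_nat.
Qed.

Lemma cup_star_nat a b (p : Hom one (a \ox b)) x y (f : Hom x y) :
  f \oc (cup p x)^# = (cup p y)^# \oc (a |> b |> f).
Proof.
by apply: star_inj; rewrite !star_comp !starK !wstar cup_nat.
Qed.

Lemma fus_starM k k' a b (s : Hom k (a \ox b)) (t : Hom k' (a \ox b)) x :
  (fus s x)^# \oc fus t x = (s^# \oc t) \xm idm x.
Proof.
rewrite !fus.unlock star_comp wstarl compA.
rewrite (@comp_chain2 _ _ _ _ _ _ _ (assocV a b x)^# _ (idm _)).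
  by rewrite compm1 -wcompl.
by rewrite /assocV eqm_star eqmK.
Qed.

Lemma cup_starM a b (p q : Hom one (a \ox b)) x z :
  p^# \oc q = z *: idm one -> (cup p x)^# \oc cup q x = z *: idm x.
Proof.
move=> pq; rewrite !cup.unlock star_comp compA (comp_chain2 _ (fus_starM _ _ _)) pq tensmZl.
by rewrite compZr compZl tensm1 compm1 /lunitV eqm_star eqmK.
Qed.

Lemma fusZ k a b (t : Hom k (a \ox b)) z x : fus (z *: t) x = z *: fus t x.
Proof. by rewrite !fus.unlock tensmZl compZr. Qed.

Lemma cupZ a b (t : Hom one (a \ox b)) z x : cup (z *: t) x = z *: cup t x.
Proof. by rewrite !cup.unlock fusZ compZl. Qed.

Lemma fus_compw k a b b' (t : Hom k (a \ox b)) (f : Hom b b') x :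
  fus ((a |> f) \oc t) x = (a |> (f \xm idm x)) \oc fus t x.
Proof.
rewrite !fus.unlock wcompl !compA; congr (_ \oc _).
by apply: pack_inj; rewrite /assocV !packE ptensA.
Qed.

Lemma cup_compw a b b' (t : Hom one (a \ox b)) (f : Hom b b') x :
  cup ((a |> f) \oc t) x = (a |> (f \xm idm x)) \oc cup t x.
Proof. by rewrite !cup.unlock fus_compw compA. Qed.

Lemma fus_compl k a a' b (t : Hom k (a \ox b)) (f : Hom a a') x :
  fus ((f \xm idm b) \oc t) x = (f \xm idm (b \ox x)) \oc fus t x.
Proof.
rewrite !fus.unlock wcompl !compA; congr (_ \oc _).
by apply: pack_inj; rewrite /assocV !packE ptensA.
Qed.

Lemma cup_compl a a' b (t : Hom one (a \ox b)) (f : Hom a a') x :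
  cup ((f \xm idm b) \oc t) x = (f \xm idm (b \ox x)) \oc cup t x.
Proof. by rewrite !cup.unlock fus_compl compA. Qed.

(** The families [F x] that act on the left of [x] only: [F (x y)] is [F x]
    tensored with the identity of [y].  Between objects [a x] and [b x] they are
    the families [f (x) 1_x] with [f : a -> b], by [istail_end]. *)
Definition istail (A B : C -> C) (F : forall x, Hom (A x) (B x)) : Prop :=
  forall x y, pack (F (x \ox y)) = ptens (pack (F x)) (pack (idm y)).

Lemma istail_tens a b (f : Hom a b) : istail (fun x => f \xm idm x).
Proof. by move=> x y; rewrite !packE ptensA. Qed.

Lemma istail_comp A B D (F : forall x, Hom (A x) (B x)) (G : forall x, Hom (B x) (D x)) :
  istail G -> istail F -> istail (fun x => G x \oc F x).
Proof.
move=> tG tF x y; rewrite pack_comp tG tF -!pack_tens; rewrite <- pack_comp.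
by rewrite -wcompl.
Qed.

Lemma istail_w a A B (F : forall x, Hom (A x) (B x)) :
  istail F -> istail (fun x => a |> F x).
Proof. by move=> tF x y; rewrite !pack_tens tF ptensA. Qed.

Lemma istail_star A B (F : forall x, Hom (A x) (B x)) :
  istail F -> istail (fun x => (F x)^#).
Proof.
by move=> tF x y; rewrite pack_star tF -[RHS]pack_tens -wstarl pack_star.
Qed.

Lemma istail_sub a A B (F : forall x, Hom (A x) (B x)) :
  istail F -> istail (fun x => F (a \ox x)).
Proof. by move=> tF x y; rewrite -tF; apply: pack_cast; rewrite tensA. Qed.

Lemma istail_fus k a b (t : Hom k (a \ox b)) : istail (fus t).
Proof. by move=> x y; rewrite !fus.unlock /assocV !packE !ptensA. Qed.

Lemma istail_cup a b (p : Hom one (a \ox b)) : istail (cup p).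
Proof. by move=> x y; rewrite !cup.unlock !fus.unlock /assocV /lunitV !packE !ptensA. Qed.

Lemma istail_end a b (F : forall x, Hom (a \ox x) (b \ox x)) :
  istail F -> exists f, forall x, F x = f \xm idm x.
Proof.
move=> tF; exists (eqm (teno1 b) \oc F one \oc eqm (esym (teno1 a))) => x.
apply: pack_inj; rewrite pack_tens pack_er pack_el -tF.
by apply: pack_cast; rewrite ten1o.
Qed.

Lemma istail_one a b (F : forall x, Hom (a \ox x) (b \ox x)) (f : Hom a b) :
  istail F -> pack (F one) = pack f -> forall x, F x = f \xm idm x.
Proof.
move=> /istail_end[g Fg]; rewrite Fg pack_tens ptensm1 => /pack_inj <- x.
exact: Fg.
Qed.

(** If [a] is irreducible, such a family of endomorphisms is a scalar; this is
    how scalars are extracted from diagrams. *)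
Lemma istail_irr a (F : forall x, Hom (a \ox x) (a \ox x)) :
  irreducible a -> istail F -> exists z, forall x, F x = z *: idm (a \ox x).
Proof.
move=> [_ irr] /istail_end[f Ff]; have [z fz] := irr f; exists z => x.
by rewrite Ff fz tensmZl tensm1.
Qed.

Lemma irr_teno1 a : irreducible a -> irreducible (a \ox one).
Proof. by rewrite teno1. Qed.

Lemma tail_scal_inj a z z' : irreducible a ->
  (forall x, z *: idm (a \ox x) = z' *: idm (a \ox x)) -> z = z'.
Proof. by move=> /irr_teno1[a0 _] /(_ one) /(scal_inj a0). Qed.

Lemma tail_pos a z B (F : forall x, Hom (a \ox x) (B x)) : irreducible a ->
  (forall x, (F x)^# \oc F x = z *: idm (a \ox x)) -> 0 <= z.
Proof. by move=> /irr_teno1 irr /(_ one); apply: irr_pos. Qed.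

(** A conjugate equation holds in front of any object. *)
Lemma conj_tail a ab (r : Hom one (ab \ox a)) (rb : Hom one (a \ox ab)) :
  conjugate_eqs r rb ->
  forall x, (cup rb (a \ox x))^# \oc (a |> cup r x) = idm (a \ox x).
Proof.
move=> [E _] x; rewrite -(tensm1 a x).
move: x; apply: istail_one.
  exact (istail_comp (istail_sub a (istail_star (istail_cup rb))) (istail_w a (istail_cup r))).
move/(congr1 (@pack _ _ _ _)): E => <-.
rewrite /lunit /runitV /assocm !cup.unlock !fus.unlock !star_comp !wstarl.
rewrite /assocV /lunitV !wcomp !tensm_eqmr !eqm_star !compA !packE.
by rewrite !ptensm1.
Qed.

Lemma conj_sym a ab (r : Hom one (ab \ox a)) (rb : Hom one (a \ox ab)) :
  conjugate_eqs r rb -> conjugate_eqs rb r.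
Proof. by case. Qed.

Lemma standard_sym a ab (r : Hom one (ab \ox a)) (rb : Hom one (a \ox ab)) :
  standard_solution r rb -> standard_solution rb r.
Proof. by case=> -[? ?] H; split. Qed.

End Tails.

(** * Braids *)

Section Braids.
Variables (R : realType) (C : strict_tensor_category R) (E : braiding C).
Implicit Types a b c d k x y : C.
Local Notation beta := (beta E).

Lemma istail_beta a b : istail (beta a b).
Proof. by move=> x y; rewrite !beta.unlock /assocV /assocm !packE !ptensA. Qed.

Lemma beta_unit a b x : unitary (beta a b x).
Proof.
rewrite beta.unlock; apply: unitary_comp; last exact: unitary_eqm.
apply: unitary_comp; first exact: unitary_eqm.
have [u1 u2] := braid_unitary E a b.
by split; rewrite wstarl -wcompl ?u1 ?u2 tensm1.
Qed.

Lemma beta_nat a b x y (f : Hom x y) :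
  beta a b y \oc (a |> b |> f) = (b |> a |> f) \oc beta a b x.
Proof.
have E1 : assocm a b y \oc (a |> b |> f) = (idm (a \ox b) \xm f) \oc assocm a b x.
  by apply: pack_inj; rewrite /assocm !packE ptensA.
have E2 : assocV b a y \oc (idm (b \ox a) \xm f) = (b |> a |> f) \oc assocV b a x.
  by apply: pack_inj; rewrite /assocV !packE ptensA.
rewrite !beta.unlock (comp_chain2 _ E1) !compA -E2; congr (_ \oc _).
rewrite -!compA; congr (_ \oc _).
by rewrite -!tensm_comp !comp1m !compm1.
Qed.

Lemma beta_natl a a' b x (f : Hom a a') :
  beta a' b x \oc (f \xm idm (b \ox x)) = (b |> (f \xm idm x)) \oc beta a b x.
Proof.
have := congr1 (fun h => h \xm idm x) (braid_natural E f (idm b)).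
rewrite !wcompl => /(congr1 (@pack _ _ _ _)) H; apply: pack_inj; move: H.
by rewrite !beta.unlock /assocm /assocV ?wcomp !compA !packE !ptensA.
Qed.

Lemma beta_natr a b b' x (f : Hom b b') :
  beta a b' x \oc (a |> (f \xm idm x)) = (f \xm idm (a \ox x)) \oc beta a b x.
Proof.
have := congr1 (fun h => h \xm idm x) (braid_natural E (idm a) f).
rewrite !wcompl => /(congr1 (@pack _ _ _ _)) H; apply: pack_inj; move: H.
by rewrite !beta.unlock /assocm /assocV ?wcomp !compA !packE !ptensA.
Qed.

(** The hexagon equations together with naturality: a morphism [k -> b c], or
    [one -> b c], can be moved across a strand. *)
Lemma hex_fusr a k b c (t : Hom k (b \ox c)) x :
  (b |> beta a c x) \oc beta a b (c \ox x) \oc (a |> fus t x)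
  = fus t (a \ox x) \oc beta a k x.
Proof.
have := congr1 (fun h => h \xm idm x) (braid_natural E (idm a) t).
rewrite !wcompl braid_tensr !wcompl.
move/(congr1 (@pack _ _ _ _)) => H; apply: pack_inj; move: H.
rewrite !beta.unlock !fus.unlock /assocm /assocV.
by rewrite !wcomp !tensm_eqmr !tensm_eqml !compA !packE !ptensA.
Qed.

Lemma hex_fusl c k a b (t : Hom k (a \ox b)) x :
  beta a c (b \ox x) \oc (a |> beta b c x) \oc fus t (c \ox x)
  = (c |> fus t x) \oc beta k c x.
Proof.
have := congr1 (fun h => h \xm idm x) (braid_natural E t (idm c)).
rewrite !wcompl braid_tensl !wcompl.
move/(congr1 (@pack _ _ _ _)) => H; apply: pack_inj; move: H.
rewrite !beta.unlock !fus.unlock /assocm /assocV.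
by rewrite !wcomp !tensm_eqmr !tensm_eqml !compA !packE !ptensA.
Qed.

Lemma yang_baxter a b c x :
  (c |> beta a b x) \oc beta a c (b \ox x) \oc (a |> beta b c x)
  = beta b c (a \ox x) \oc (b |> beta a c x) \oc beta a b (c \ox x).
Proof.
have := congr1 (fun h => h \xm idm x) (braid_natural E (idm a) (E b c)).
rewrite !wcompl !braid_tensr !wcompl.
move/(congr1 (@pack _ _ _ _)) => H; apply: pack_inj; move: H.
rewrite !beta.unlock /assocm /assocV.
by rewrite !wcomp !tensm_eqmr !tensm_eqml !compA !packE !ptensA.
Qed.

Lemma idem_unitary a (u : Hom a a) : unitary u -> u \oc u = u -> u = idm a.
Proof. by move=> [u1 _] /(congr1 (fun v => u^# \oc v)); rewrite compA u1 comp1m. Qed.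

(** The braiding with the unit object is trivial: by the hexagon equation it is
    an idempotent unitary. *)
Lemma pack_braid1r a : pack (E a one) = pack (idm a).
Proof.
pose u := eqm (ten1o a) \oc E a one \oc eqm (esym (teno1 a)).
have uE : pack u = pack (E a one) by rewrite pack_er pack_el.
rewrite -uE; congr pack; apply: idem_unitary.
  apply: unitary_comp; last exact: unitary_eqm.
  by apply: unitary_comp; [exact: unitary_eqm | exact: braid_unitary].
apply: pack_inj; rewrite pack_comp !uE.
have H : pack (E a one) = pack (E a (one \ox one)).
  by apply: pack_cast; rewrite ten1o.
by rewrite [RHS]H braid_tensr /assocm /assocV !packE !ptens1m !ptensm1.
Qed.

Lemma pack_braid1l a : pack (E one a) = pack (idm a).
Proof.
pose u := eqm (teno1 a) \oc E one a \oc eqm (esym (ten1o a)).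
have uE : pack u = pack (E one a) by rewrite pack_er pack_el.
rewrite -uE; congr pack; apply: idem_unitary.
  apply: unitary_comp; last exact: unitary_eqm.
  by apply: unitary_comp; [exact: unitary_eqm | exact: braid_unitary].
apply: pack_inj; rewrite pack_comp !uE.
have H : pack (E one a) = pack (E (one \ox one) a).
  apply: (@pack_cast _ _ (fun x => x \ox a) (fun x => a \ox x) (fun x => E x a)).
  by rewrite ten1o.
by rewrite [RHS]H braid_tensl /assocm /assocV !packE !ptens1m !ptensm1.
Qed.

Lemma beta1r a x : beta a one x \oc (a |> lunitV x) = lunitV (a \ox x).
Proof.
apply: pack_inj; rewrite !beta.unlock /lunitV /assocm /assocV !tensm_eqmr !packE.
by rewrite pack_braid1r !pack_eqm pack_idtens.
Qed.

Lemma beta1l a x : beta one a x \oc lunitV (a \ox x) = a |> lunitV x.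
Proof.
apply: pack_inj; rewrite !beta.unlock /lunitV /assocm /assocV !tensm_eqmr !packE.
by rewrite pack_braid1l !pack_eqm pack_idtens.
Qed.

Lemma hex_cupr a b c (p : Hom one (b \ox c)) x :
  (b |> beta a c x) \oc beta a b (c \ox x) \oc (a |> cup p x) = cup p (a \ox x).
Proof. by rewrite !cup.unlock wcomp compA hex_fusr -compA beta1r. Qed.

Lemma hex_cupl c a b (p : Hom one (a \ox b)) x :
  beta a c (b \ox x) \oc (a |> beta b c x) \oc cup p (c \ox x) = c |> cup p x.
Proof. by rewrite !cup.unlock wcomp compA hex_fusl -compA beta1l. Qed.

Lemma fus_braid k a b (s : Hom k (a \ox b)) x :
  fus (E a b \oc s) x = beta a b x \oc fus s x.
Proof.
rewrite fus.unlock beta.unlock wcompl !compA -(compA _ (assocm _ _ _)).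
by rewrite /assocm /assocV eqmK compm1.
Qed.

End Braids.

(** * Conjugate objects and partial traces *)

Section Conjugates.
Variables (R : realType) (C : strict_tensor_category R) (E : braiding C).
Hypothesis one_irr : irreducible (one : C).
Implicit Types a b c k x y : C.
Local Notation beta := (beta E).

Lemma ltr_nat a ab (r : Hom one (ab \ox a)) x y x' y' (f : Hom (a \ox x) (a \ox y))
    (g : Hom x' x) (h : Hom y y') :
  ltr r ((a |> h) \oc f \oc (a |> g)) = h \oc ltr r f \oc g.
Proof.
by rewrite !ltr.unlock !compA cup_star_nat (comp_chain2 _ (cup_nat r g)) !wcomp !compA.
Qed.

Lemma ltrZ a ab (r : Hom one (ab \ox a)) x y (f : Hom (a \ox x) (a \ox y)) z :
  ltr r (z *: f) = z *: ltr r f.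
Proof. by rewrite !ltr.unlock tensmZr compZr compZl. Qed.

Lemma ltr_sum a ab (r : Hom one (ab \ox a)) x y (I : Type) (s : seq I) (P : pred I)
    (F : I -> Hom (a \ox x) (a \ox y)) :
  ltr r (\sum_(i <- s | P i) F i) = \sum_(i <- s | P i) ltr r (F i).
Proof. by rewrite !ltr.unlock tensm_sumr comp_sumr comp_suml. Qed.

Lemma ltr_star a ab (r : Hom one (ab \ox a)) x y (f : Hom (a \ox x) (a \ox y)) :
  ltr r f^# = (ltr r f)^#.
Proof. by rewrite !ltr.unlock !star_comp starK wstar compA. Qed.

Lemma istail_ltr a ab (r : Hom one (ab \ox a)) A B
    (F : forall x, Hom (a \ox A x) (a \ox B x)) :
  istail (fun x => cup r (A x)) -> istail (fun x => cup r (B x)) ->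
  istail F -> istail (fun x => ltr r (F x)).
Proof.
move=> tA tB tF x y; rewrite !ltr.unlock.
exact: (istail_comp (istail_comp (istail_star tB) (istail_w ab tF)) tA x y).
Qed.

(** A solution of the conjugate equations for an irreducible object,
    normalized as a standard solution, in the form in which it is used: all
    the equations hold in front of an arbitrary object [x].  The numbers [d]
    and [w] are the dimension and the phase. *)
Record std a ab (r : Hom one (ab \ox a)) (rb : Hom one (a \ox ab)) (d w : R[i]) : Prop :=
  Std {
  std_irr : irreducible a;
  std_irrb : irreducible ab;
  std_zig : forall x, (cup rb (a \ox x))^# \oc (a |> cup r x) = idm (a \ox x);
  std_zag : forall x, (cup r (ab \ox x))^# \oc (ab |> cup rb x) = idm (ab \ox x);
  std_d : forall x, (cup r x)^# \oc cup r x = d *: idm x;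
  std_db : forall x, (cup rb x)^# \oc cup rb x = d *: idm x;
  std_d0 : 0 < d;
  std_w : forall x, ltr r (beta a a x) = w *: idm (a \ox x)
}.

Section Std.
Variables (a ab : C) (r : Hom one (ab \ox a)) (rb : Hom one (a \ox ab)) (d w : R[i]).
Hypothesis S : std r rb d w.

Lemma std_zig' x : (a |> (cup r x)^#) \oc cup rb (a \ox x) = idm (a \ox x).
Proof. by apply: star_inj; rewrite star_comp wstar starK (std_zig S) star1. Qed.

Lemma ltr1 x : ltr r (idm (a \ox x)) = d *: idm x.
Proof. by rewrite !ltr.unlock tensm1 compm1 (std_d S). Qed.

End Std.

Lemma tens_one_inj a b (f g : Hom a b) : f \xm idm one = g \xm idm one -> f = g.
Proof. by move=> /(congr1 (@pack _ _ _ _)); rewrite !packE !ptensm1 => /pack_inj. Qed.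

Lemma tens_swap a a' b b' (f : Hom a a') (g : Hom b b') :
  (f \xm idm b') \oc (a |> g) = (a' |> g) \oc (f \xm idm b).
Proof. by rewrite -!tensm_comp !comp1m !compm1. Qed.

(** Bending a strand identifies [End(ab)] with [End(a)]. *)
Lemma irr_conj a ab (r : Hom one (ab \ox a)) (rb : Hom one (a \ox ab)) :
  irreducible a -> conjugate_eqs r rb -> irreducible ab.
Proof.
move=> irr ce; have ce' := conj_sym ce; split=> [ab0|f].
  have [+ _] := irr_teno1 irr; apply.
  rewrite -(conj_tail ce one).
  have : idm (ab \ox (a \ox one)) = 0.
    by rewrite -tensm1 ab0 tensm0l.
  move=> z0; rewrite -[cup r one]comp1m.
  by rewrite z0 comp0l tensm0r comp0r.
pose g x := (a |> (cup r x)^#) \oc (a |> (f \xm idm (a \ox x))) \oc cup rb (a \ox x).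
have tg : istail g.
  exact: (istail_comp (istail_comp (istail_w a (istail_star (istail_cup r)))
    (istail_w a (istail_sub a (istail_tens f)))) (istail_sub a (istail_cup rb))).
have [z gz] := istail_irr irr tg; exists z; apply: tens_one_inj.
have gc : g (ab \ox one) \oc cup rb one = (a |> (f \xm idm one)) \oc cup rb one.
  rewrite /g -compA cup_nat !compA -!wcomp; congr (_ \oc _); congr (_ |> _).
  by rewrite -compA tens_swap compA (conj_tail ce') comp1m.
have := congr1 (fun h => (cup r (ab \ox one))^# \oc (ab |> h)) gc.
rewrite gz compZl comp1m tensmZr compZr (conj_tail ce') tensmZl tensm1 => ->.
by rewrite wcomp compA -cup_star_nat -compA (conj_tail ce') compm1.
Qed.

(** The conjugate equations follow from their form in front of [x], at
    [x = one]. *)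
Lemma conj_of_tail a ab (r : Hom one (ab \ox a)) (rb : Hom one (a \ox ab)) :
  (forall x, (cup rb (a \ox x))^# \oc (a |> cup r x) = idm (a \ox x)) ->
  (forall x, (cup r (ab \ox x))^# \oc (ab |> cup rb x) = idm (ab \ox x)) ->
  conjugate_eqs r rb.
Proof.
have half u v (p : Hom one (v \ox u)) (q : Hom one (u \ox v)) :
    (forall x, (cup q (u \ox x))^# \oc (u |> cup p x) = idm (u \ox x)) ->
    lunit u \oc (q^# \xm 1_u) \oc assocm u v u \oc (1_u \xm p) \oc runitV u = 1_u.
  move=> /(_ one) /(congr1 (@pack _ _ _ _)) H; apply: pack_inj; move: H.
  rewrite /lunit /runitV /assocm !cup.unlock !fus.unlock !star_comp !wstarl.
  rewrite /assocV /lunitV !wcomp !tensm_eqmr !eqm_star !compA !packE.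
  by rewrite !ptensm1.
by move=> H1 H2; split; apply: half.
Qed.

(** A standard solution for an irreducible object satisfies the equations of
    [std], with the scalars of the defining diagrams. *)
Lemma std_of_standard a ab (r : Hom one (ab \ox a)) (rb : Hom one (a \ox ab)) :
  irreducible a -> standard_solution r rb ->
  exists d w, [/\ std r rb d w, r^# \oc r = d *: 1_one &
    lunit a \oc (r^# \xm 1_a) \oc assocm ab a a \oc (1_ab \xm E a a)
      \oc assocV ab a a \oc (r \xm 1_a) \oc lunitV a = w *: 1_a].
Proof.
move=> irr [ce nrm]; have [_ irr1] := one_irr.
have [d rd] := irr1 (r^# \oc r); have [_ irra] := irr.
have [w rw] := irra (lunit a \oc (r^# \xm 1_a) \oc assocm ab a a \oc (1_ab \xm E a a)
      \oc assocV ab a a \oc (r \xm 1_a) \oc lunitV a).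
have d0 : 0 < d.
  apply: (irr_gt0 one_irr rd) => r0; have [+ _] := irr_teno1 irr; apply.
  rewrite -(conj_tail ce one).
  by rewrite r0 -(scale0r (0 : Hom one (ab \ox a))) cupZ scale0r tensm0r comp0r.
exists d, w; split=> //; split=> //.
- exact: irr_conj ce.
- exact: conj_tail.
- exact: conj_tail (conj_sym ce).
- by move=> x; apply: cup_starM.
- by move=> x; apply: cup_starM; rewrite -nrm.
- move=> x; rewrite -tensm1 -tensmZl.
  have tl := istail_sub a (istail_cup r).
  have tt := istail_ltr tl tl (istail_beta E a a).
  apply: (istail_one tt); rewrite -rw ltr.unlock !beta.unlock !cup.unlock !fus.unlock.
  rewrite !star_comp !wstarl !wcomp !compA.
  rewrite /lunit /assocm /assocV /lunitV !tensm_eqmr !eqm_star !packE.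
  by rewrite !ptensA !ptensm1.
Qed.

End Conjugates.

(** * Dimension and phase *)

Section Dimension.
Variables (R : realType) (C : strict_tensor_category R) (E : braiding C).
Hypothesis one_irr : irreducible (one : C).
Implicit Types a b c k x y : C.
Local Notation beta := (beta E).
Local Notation std := (std E).

(** Rescaling a solution of the conjugate equations. *)
Lemma conj_scale a ab (r : Hom one (ab \ox a)) (rb : Hom one (a \ox ab)) (s t : R[i]) :
  s^* * t = 1 -> conjugate_eqs r rb -> conjugate_eqs (t *: r) (s *: rb).
Proof.
move=> st ce; have st' : t^* * s = 1.
  by rewrite -[LHS]conjCK rmorphM /= conjCK mulrC st rmorph1.
apply: conj_of_tail => x.
  by rewrite !cupZ tensmZr starZ compZl compZr scalerA st (conj_tail ce) scale1r.
by rewrite !cupZ tensmZr starZ compZl compZr scalerA st' (conj_tail (conj_sym ce)) scale1r.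
Qed.

(** Any solution of the conjugate equations for an irreducible object can be
    normalized. *)
Lemma standard_exists a : irreducible a ->
  (exists (ab : C) (r : Hom one (ab \ox a)) (rb : Hom one (a \ox ab)), conjugate_eqs r rb) ->
  exists (ab : C) (r : Hom one (ab \ox a)) (rb : Hom one (a \ox ab)), standard_solution r rb.
Proof.
move=> irr [ab [r [rb ce]]]; have [_ irr1] := one_irr.
have [al ral] := irr1 (r^# \oc r); have [be rbe] := irr1 (rb^# \oc rb).
have nz : idm (a \ox one) <> 0 by have [] := irr_teno1 irr.
have al0 : 0 < al.
  apply: (irr_gt0 one_irr ral) => r0; apply: nz; rewrite -(conj_tail ce one).
  by rewrite r0 -(scale0r (0 : Hom one (ab \ox a))) cupZ scale0r tensm0r comp0r.
have be0 : 0 < be.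
  apply: (irr_gt0 one_irr rbe) => r0; apply: nz; rewrite -(conj_tail ce one).
  by rewrite r0 -(scale0r (0 : Hom one (a \ox ab))) cupZ scale0r star0 comp0l.
(* Rescaling by t and t^-1 makes the norms t^2 al and t^-2 be. *)
pose t : R[i] := sqrtC (sqrtC (be / al)).
have t0 : 0 < t by rewrite !sqrtC_gt0 divr_gt0.
have tR : t^* = t by rewrite geC0_conj // ltW.
have t4 : t ^+ 2 * al = t ^- 2 * be.
  apply: (@mulfI _ (t ^+ 2)); first by rewrite expf_neq0 // gt_eqF.
  have t22 : t ^+ 2 * t ^+ 2 = be / al by rewrite -expr2 /t !sqrtCK.
  rewrite [LHS]mulrA t22 [RHS]mulrA divfK ?gt_eqF // mulfV ?mul1r //.
  by rewrite expf_neq0 // gt_eqF.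
exists ab, (t *: r), (t^-1 *: rb); split.
  by apply: conj_scale => //; rewrite fmorphV /= tR mulVf // gt_eqF.
rewrite !starZ !compZl !compZr ral rbe !scalerA fmorphV /= tR -invfM -!expr2 t4.
by [].
Qed.

(** Replacing the conjugate by an equivalent object. *)
Lemma standard_transport a ab ab' (r : Hom one (ab \ox a)) (rb : Hom one (a \ox ab))
    (u : Hom ab ab') :
  unitary u -> standard_solution r rb ->
  standard_solution ((u \xm idm a) \oc r) ((a |> u) \oc rb).
Proof.
move=> [u1 u2] [ce nrm]; split.
  apply: conj_of_tail => x; rewrite cup_compw cup_compl.
    rewrite star_comp wstar wstarl wcomp !compA -(compA (cup rb _)^#).
    by rewrite -wcomp -wcompl u1 !tensm1 compm1 (conj_tail ce).
  rewrite star_comp wstarl wcomp !compA -(compA (cup r _)^#) tens_swap !compA.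
  rewrite -cup_star_nat -(compA _ (u^# \xm _)) tens_swap compA -(compA _ (cup r _)^#).
  by rewrite (conj_tail (conj_sym ce)) compm1 -wcompl u2 tensm1.
rewrite !star_comp wstarl wstar !compA -(compA r^#) -(compA rb^#) -wcomp -wcompl.
by rewrite u1 !tensm1 !compm1.
Qed.

Section Uniqueness.
Variables (a ab ab' : C) (r : Hom one (ab \ox a)) (rb : Hom one (a \ox ab)).
Variables (r' : Hom one (ab' \ox a)) (rb' : Hom one (a \ox ab')) (d w d' w' : R[i]).
Hypotheses (S : std r rb d w) (S' : std r' rb' d' w').

(** Two standard solutions for [a] differ by a unitary between the two
    conjugates. *)
Lemma std_compare : exists u : Hom ab ab',
  [/\ forall x, cup r' x = (u \xm idm (a \ox x)) \oc cup r x,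
      forall x, cup rb x = (a |> (u^# \xm idm x)) \oc cup rb' x & unitary u].
Proof.
pose v x := (ab' |> (cup rb x)^#) \oc cup r' (ab \ox x).
have tv : istail v.
  exact: (istail_comp (istail_w ab' (istail_star (istail_cup rb)))
    (istail_sub ab (istail_cup r'))).
have [u vu] := istail_end tv; exists u.
have E1 x : cup r' x = (u \xm idm (a \ox x)) \oc cup r x.
  rewrite -vu /v -compA cup_nat compA -wcomp.
  by rewrite (std_zig S) tensm1 comp1m.
have E2 x : cup rb x = (a |> (u^# \xm idm x)) \oc cup rb' x.
  rewrite -wstarl -vu /v star_comp wstar starK wcomp -compA -cup_nat compA.
  by rewrite (std_zig' S') comp1m.
have [mu uu] := (std_irrb S).2 (u^# \oc u).
have [mu' uu'] := (std_irrb S').2 (u \oc u^#).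
have d'E : d' = mu * d.
  apply: (scal_inj one_irr.1); rewrite -(std_d S' one) E1 star_comp wstarl.
  rewrite compA -(compA _ (u^# \xm _)) -wcompl uu tensmZl tensm1 compZr compm1 compZl.
  by rewrite (std_d S) scalerA.
have dE : d = mu' * d'.
  apply: (scal_inj one_irr.1); rewrite -(std_db S one) E2 star_comp wstar wstarl starK.
  rewrite compA -(compA _ (a |> (u \xm _))) -wcomp -wcompl uu' tensmZl tensm1 tensmZr tensm1.
  by rewrite compZr compm1 compZl (std_db S') scalerA.
have mumu : mu = mu'.
  apply/eqP; rewrite -subr_eq0; apply/eqP.
  have : mu *: u = mu' *: u.
    by rewrite -{1}[u]compm1 -compZr -uu compA uu' compZl comp1m.
  move/eqP; rewrite -subr_eq0 -scalerBl scaler_eq0 => /orP[/eqP //|/eqP u0].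
  case: (negP (lt0r_neq0 (std_d0 S'))); rewrite d'E.
  suff -> : mu = 0 by rewrite mul0r.
  apply: (scal_inj (std_irrb S).1).
  by rewrite -uu u0 comp0r scale0r.
(* d' = mu d and d = mu d' with mu >= 0. *)
have mu1 : mu = 1.
  have mu0 : 0 <= mu by apply: (irr_pos (std_irrb S) uu).
  have : mu ^+ 2 = 1.
    apply: (mulIf (lt0r_neq0 (std_d0 S'))).
    by rewrite mul1r [RHS]d'E dE mumu expr2 mulrA.
  by move/eqP; rewrite sqrp_eq1 // => /eqP.
by split=> //; split; rewrite ?uu ?uu' -?mumu mu1 scale1r.
Qed.

Lemma std_unique : d = d' /\ w = w'.
Proof.
have [u [E1 E2 [u1 u2]]] := std_compare; split.
  apply: (scal_inj one_irr.1); rewrite -(std_d S' one) -(std_d S one) E1 star_comp wstarl.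
  by rewrite compA -(compA _ (u^# \xm _)) -wcompl u1 tensm1 compm1.
apply: (scal_inj (irr_teno1 (std_irr S)).1).
rewrite -(std_w S one) -(std_w S' one) !ltr.unlock !E1 star_comp wstarl.
rewrite !compA -(compA _ (ab' |> _)) -tens_swap !compA -(compA _ (u^# \xm _)).
by rewrite -wcompl u1 tensm1 compm1.
Qed.

End Uniqueness.

(** The dimension and the phase can be computed from any standard solution. *)
Lemma std_qdim_phase a ab (r : Hom one (ab \ox a)) (rb : Hom one (a \ox ab)) :
  irreducible a -> standard_solution r rb -> std r rb (qdim a) (phase E a).
Proof.
move=> irr ss; have [d [w [S rd rw]]] := std_of_standard E one_irr irr ss.
suff [-> ->] : qdim a = d /\ phase E a = w by [].
split.
  rewrite /qdim; case: xgetP => [z _ [ab' [r' [rb' [ss' rz]]]]|/(_ d)[]]; last first.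
    by exists ab, r, rb.
  have [d' [w' [S' rd' rw']]] := std_of_standard E one_irr irr ss'.
  have -> : z = d' by apply: (scal_inj one_irr.1); rewrite -rz.
  by have [] := std_unique S S'.
rewrite /phase; case: xgetP => [z _ [ab' [r' [rb' [ss' rz]]]]|/(_ w)[]]; last first.
  by exists ab, r, rb.
have [d' [w' [S' rd' rw']]] := std_of_standard E one_irr irr ss'.
have -> : z = w' by apply: (scal_inj irr.1); rewrite -rz.
by have [] := std_unique S S'.
Qed.

End Dimension.

(** * Properties of the phase *)

Lemma mulr_pairC (F : comPzRingType) (x y z x' y' z' : F) :
  x' * y' * z * (x * y * z') = (x * x') * (y * y') * (z * z').
Proof. by ring. Qed.

Lemma mulr_inv_pair (F : fieldType) (x y z : F) : x != 0 -> y != 0 -> z != 0 ->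
  z / (x * y) * (x * y / z) = 1.
Proof. by move=> x0 y0 z0; field; rewrite x0 y0 z0. Qed.

Section Phase.
Variables (R : realType) (C : strict_tensor_category R) (E : braiding C).
Implicit Types a b c k x y : C.
Local Notation beta := (beta E).
Local Notation std := (std E).

Lemma beta_starK a b x : (beta a b x)^# \oc beta a b x = idm (a \ox (b \ox x)).
Proof. by have [] := beta_unit E a b x. Qed.

Lemma wbeta_starK c a b x :
  (c |> (beta a b x)^#) \oc (c |> beta a b x) = idm (c \ox (a \ox (b \ox x))).
Proof. by rewrite -wcomp beta_starK tensm1. Qed.

Section Conj.
Variables (a ab : C) (r : Hom one (ab \ox a)) (rb : Hom one (a \ox ab)) (d w : R[i]).
Hypothesis S : std r rb d w.

(** Sliding one leg of the cup [r] across the other gives the cup [rb], up to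
    the conjugate of the phase. *)
Lemma beta_cup_conj x : beta ab a x \oc cup r x = w^* *: cup rb x.
Proof.
pose P x := beta ab a x \oc cup r x.
pose g x := (a |> (cup r x)^#) \oc P (a \ox x).
have tP : istail P by exact: (istail_comp (istail_beta E ab a) (istail_cup r)).
have tg : istail g.
  exact: (istail_comp (istail_w a (istail_star (istail_cup r))) (istail_sub a tP)).
have [z gz] := istail_irr (std_irr S) tg.
have -> : w^* = z.
  apply: (tail_scal_inj (std_irr S)) => y.
  have := congr1 (fun f => f^#) (std_w S y); rewrite /= starZ star1 => <-; rewrite -gz.
  rewrite ltr.unlock !star_comp starK /g /P -[a |> (cup r y)^#]wstar.
  rewrite -(hex_cupl E a r y) !star_comp !wstar !compA.
  by rewrite (comp_chain2 _ (beta_starK _ _ _)) compm1.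
rewrite -/(P x).
have -> : P x = g (ab \ox x) \oc cup rb x.
  rewrite /g -compA /P -compA cup_nat.
  rewrite (compA (beta _ _ _)) beta_nat !compA -wcomp (std_zag S).
  by rewrite tensm1 comp1m.
by rewrite gz compZl comp1m.
Qed.

Lemma phase_unit : w * w^* = 1.
Proof.
apply: (mulfI (lt0r_neq0 (std_d0 S))); rewrite mulr1.
have := std_d S (a \ox one); have := std_db S (a \ox one).
have := congr1 (fun f => f^# \oc f) (beta_cup_conj (a \ox one)).
rewrite /= starZ star_comp !compZl !compZr compA (comp_chain2 _ (beta_starK _ _ _)) compm1.
move=> -> ->; rewrite !scalerA conjCK => /(scal_inj (irr_teno1 (std_irr S)).1).
by rewrite mulrC.
Qed.

Lemma cup_conjE x : cup rb x = w *: (beta ab a x \oc cup r x).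
Proof. by rewrite beta_cup_conj scalerA phase_unit scale1r. Qed.

(** The phase, defined as a left partial trace of the self-braiding of [a], is
    also its right partial trace: the closing strand can be dragged from one
    side to the other, and this conjugates the self-braiding by itself. *)
Lemma phase_right x :
  (a |> (cup rb x)^#) \oc beta a a (ab \ox x) \oc (a |> cup rb x) = w *: idm (a \ox x).
Proof.
rewrite cup_conjE starZ !tensmZr !compZl compZr scalerA mulrC phase_unit scale1r.
rewrite star_comp !wcomp -(hex_cupl E a r x).
rewrite -[a |> (cup r x)^#]wstar -(hex_cupl E a r x) !star_comp !wstar !compA.
rewrite (comp_chain3 _ (esym (yang_baxter E ab a a x))) !compA.
rewrite (comp_chain2 _ (wbeta_starK _ _ _ _)) compm1 (comp_chain2 _ (beta_starK _ _ _)) compm1.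
by rewrite (comp_chain2 _ (wbeta_starK _ _ _ _)) compm1 -(std_w S) ltr.unlock.
Qed.

End Conj.

(** Conjugate objects have the same phase. *)
Lemma phase_conj a ab (r : Hom one (ab \ox a)) (rb : Hom one (a \ox ab)) d w d' w' :
  std r rb d w -> std rb r d' w' -> w' = w.
Proof.
move=> S S'; have w1 := phase_unit S'.
suff : w'^* * w = 1.
  by move=> /(congr1 (fun z => w' * z)); rewrite mulrA w1 mul1r mulr1 => ->.
apply: (tail_scal_inj (std_irr S)) => x; rewrite scale1r -[RHS](std_zig' S).
rewrite (cup_conjE S') starZ star_comp tensmZr wcomp -(hex_cupr E a rb x).
rewrite !compA compZl !compZl (comp_chain2 _ (wbeta_starK _ _ _ _)) compm1.
by rewrite (phase_right S) scalerA.
Qed.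

End Phase.

(** * Traces over a product of two irreducible objects *)

(** The morphism [b -> a' k] obtained from [s^# : a b -> k] by bending [a]. *)
HB.lock Definition rot (R : realType) (C : strict_tensor_category R) (a a' b k : C)
    (r : Hom one (a' \ox a)) (s : Hom k (a \ox b)) (x : C) :
    Hom (b \ox x) (a' \ox (k \ox x)) :=
  (a' |> (fus s x)^#) \oc cup r (b \ox x).

(** The morphism [b k' -> a'] obtained from [s^# : a b -> k] by bending [a] and [k]. *)
HB.lock Definition rot2 (R : realType) (C : strict_tensor_category R) (a a' b k k' : C)
    (r : Hom one (a' \ox a)) (q : Hom one (k \ox k')) (s : Hom k (a \ox b)) (x : C) :
    Hom (b \ox (k' \ox x)) (a' \ox x) :=
  (a' |> (cup q x)^#) \oc rot r s (k' \ox x).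

(** The monodromy of the first two factors of [a (b x)]. *)
HB.lock Definition mono (R : realType) (C : strict_tensor_category R) (E : braiding C)
    (a b x : C) : Hom (a \ox (b \ox x)) (a \ox (b \ox x)) :=
  beta E b a x \oc beta E a b x.

Section Product.
Variables (R : realType) (C : strict_tensor_category R) (E : braiding C).
Implicit Types x y : C.
Local Notation beta := (beta E).
Local Notation std := (std E).
Variables (a a' : C) (ra : Hom one (a' \ox a)) (ra' : Hom one (a \ox a')) (da wa : R[i]).
Variables (b b' : C) (rb : Hom one (b' \ox b)) (rb' : Hom one (b \ox b')) (db wb : R[i]).
Variables (k k' : C) (rk : Hom one (k' \ox k)) (rk' : Hom one (k \ox k')) (dk wk : R[i]).
Hypothesis Sa : std ra ra' da wa.
Hypothesis Sb : std rb rb' db wb.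
Hypothesis Sk : std rk rk' dk wk.
Implicit Types s t : Hom k (a \ox b).

Local Notation rot := (rot ra).
Local Notation rot2 := (rot2 ra rk').
Local Notation mono := (mono E).

Let rot_nat s x y (f : Hom x y) : rot s y \oc (b |> f) = (a' |> k |> f) \oc rot s x.
Proof.
by rewrite !rot.unlock -compA cup_nat !compA -!wcomp fus_star_nat.
Qed.

Let rot2_nat s x y (f : Hom x y) : rot2 s y \oc (b |> k' |> f) = (a' |> f) \oc rot2 s x.
Proof.
by rewrite !rot2.unlock -compA rot_nat !compA -!wcomp cup_star_nat.
Qed.

Let rot_rot2 s x : rot s x = rot2 s (k \ox x) \oc (b |> cup rk x).
Proof.
by rewrite !rot2.unlock -compA rot_nat compA -wcomp (std_zig Sk) tensm1 comp1m.
Qed.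

Let istail_rot2 s : istail (rot2 s).
Proof.
have tr : istail (rot s).
  move=> x y; rewrite !rot.unlock.
  exact: (istail_comp (istail_w a' (istail_star (istail_fus s)))
    (istail_sub b (istail_cup ra)) x y).
move=> x y; rewrite !rot2.unlock.
exact: (istail_comp (istail_w a' (istail_star (istail_cup rk'))) (istail_sub k' tr) x y).
Qed.

(** The Gram matrix of [Hom(k, a b)], through [s |-> rot2 s], which is
    antilinear; its entries are scalars because [k'] is irreducible. *)
Let gram_ex s t : exists z, forall x,
  ltr rb ((rot2 s x)^# \oc rot2 t x) = z *: idm (k' \ox x).
Proof.
apply: (istail_irr (std_irrb Sk)).
have tc := istail_sub k' (istail_cup rb).
exact: (istail_ltr tc tc (istail_comp (istail_star (istail_rot2 s)) (istail_rot2 t))).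
Qed.

Let gram s t : R[i] := xget 0 [set z | forall x,
  ltr rb ((rot2 s x)^# \oc rot2 t x) = z *: idm (k' \ox x)]%classic.

Let gramE s t x : ltr rb ((rot2 s x)^# \oc rot2 t x) = gram s t *: idm (k' \ox x).
Proof.
rewrite /gram; have [z zP] := gram_ex s t.
by case: xgetP => [y _ //|/(_ z)]; case.
Qed.

Let gram_conj s t : gram t s = (gram s t)^*.
Proof.
apply: (tail_scal_inj (std_irrb Sk)) => x; rewrite -gramE.
by rewrite -[_ \oc _]starK ltr_star star_comp starK gramE starZ star1.
Qed.

Let gram_pos s : 0 <= gram s s.
Proof.
apply: (@tail_pos _ _ _ _ _ (fun x => (b' |> rot2 s x) \oc cup rb (k' \ox x)) (std_irrb Sk)).
move=> x; rewrite -gramE ltr.unlock star_comp wstar wcomp !compA; congr (_ \oc _).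
Qed.

(** The double partial trace of a morphism that factors through [k], in terms
    of the Gram matrix. *)
Let ltr2_gram s t x y (M : Hom (k \ox x) (k \ox y)) :
  ltr rb (ltr ra (fus s y \oc M \oc (fus t x)^#)) = gram s t *: ltr rk M.
Proof.
have -> : ltr ra (fus s y \oc M \oc (fus t x)^#) = (rot s y)^# \oc (a' |> M) \oc rot t x.
  by rewrite ltr.unlock !rot.unlock star_comp wstar starK !wcomp !compA.
rewrite !rot_rot2 star_comp wstar.
rewrite -!compA (compA (a' |> M)) -rot2_nat !compA.
have -> : (b |> (cup rk y)^#) \oc (rot2 s (k \ox y))^# \oc rot2 t (k \ox y) \oc
    (b |> k' |> M) \oc (b |> cup rk x) =
    (b |> (cup rk y)^#) \oc ((rot2 s (k \ox y))^# \oc rot2 t (k \ox y)) \oc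
    (b |> ((k' |> M) \oc cup rk x)).
  by rewrite wcomp !compA.
rewrite ltr_nat gramE compZr compm1 compZl ltr.unlock.
by rewrite compA.
Qed.

(** The braiding of [a b] with itself. *)
Let cc x := (a |> beta a b (b \ox x)) \oc beta a a (b \ox (b \ox x))
  \oc (a |> a |> beta b b x) \oc (a |> beta b a (b \ox x)).

(** The phase of the product [a b] is a multiple of the monodromy of [a] and [b]. *)
Let ltr2_cc x : ltr rb (ltr ra (cc x)) = (wa * wb) *: mono a b x.
Proof.
have -> : ltr ra (cc x) = wa *: ((b |> beta b a x) \oc beta b b (a \ox x) \oc (b |> beta a b x)).
  have -> : cc x = (a |> beta a b (b \ox x)) \oc beta a a (b \ox (b \ox x))
      \oc (a |> ((a |> beta b b x) \oc beta b a (b \ox x))).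
    by rewrite /cc wcomp !compA.
  rewrite ltr_nat (std_w Sa) compZr compm1 compZl compA.
  by have := yang_baxter E b a b x; move=> ->.
rewrite ltrZ ltr_nat (std_w Sb) compZr compm1 compZl scalerA.
by rewrite mono.unlock.
Qed.

Let fus_cc s t x : (a |> b |> (fus t x)^#) \oc cc x \oc (a |> b |> fus s x)
  = fus s (k \ox x) \oc beta k k x \oc (fus t (k \ox x))^#.
Proof.
have H1 := hex_fusr E b s x; have H2 := hex_fusr E a s (b \ox x).
have H3 := hex_fusl E k t x.
pose B := beta a k (b \ox x) \oc (a |> beta b k x).
have uB : unitary B.
  apply: unitary_comp; first exact: beta_unit.
  have [u1 u2] := beta_unit E b k x.
  by split; rewrite wstar -wcomp ?u1 ?u2 tensm1.
have E1 : cc x \oc (a |> b |> fus s x) = fus s (a \ox (b \ox x)) \oc B.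
  have := congr1 (fun h => a |> h) H1; rewrite /= !wcomp => H1'.
  by rewrite /cc (comp_chain3 _ H1') /B !compA H2.
rewrite -compA E1 compA -fus_nat -!compA; congr (_ \oc _).
have H4 : B \oc fus t (k \ox x) = (k |> fus t x) \oc beta k k x by rewrite -H3.
clearbody B; apply: star_inj; rewrite !star_comp !wstar !starK.
have -> : fus t (k \ox x) = B^# \oc ((k |> fus t x) \oc beta k k x).
  by rewrite -H4 compA uB.1 comp1m.
by rewrite -!compA (proj2 (beta_unit E k k x)) compm1.
Qed.

Let mono_gram s t x :
  (wa * wb) *: ((fus t x)^# \oc mono a b x \oc fus s x) = (wk * gram s t) *: idm (k \ox x).
Proof.
have -> : (wk * gram s t) *: idm (k \ox x) = gram s t *: ltr rk (beta k k x).
  by rewrite (std_w Sk) scalerA mulrC.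
by rewrite -ltr2_gram -fus_cc !ltr_nat ltr2_cc compZr compZl.
Qed.

(** The monodromy on [Hom(k, a b)], normalized so that it turns out to be the
    identity. *)
Let amono s : Hom k (a \ox b) := (wa * wb / wk) *: (E b a \oc E a b \oc s).

Let amonoE s x : fus (amono s) x = (wa * wb / wk) *: (mono a b x \oc fus s x).
Proof.
rewrite fusZ; congr (_ *: _); apply: pack_inj.
rewrite fus.unlock mono.unlock !beta.unlock !wcompl /assocV /assocm !compA.
by rewrite !packE.
Qed.

Let wk0 : wk != 0.
Proof. by apply: contra_eq_neq (phase_unit Sk) => ->; rewrite mul0r eq_sym oner_eq0. Qed.

Let amono_gram s t : t^# \oc amono s = gram s t *: idm k.
Proof.
apply: tens_one_inj; rewrite -fus_starM amonoE compZr compA tensmZl tensm1.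
by rewrite mulrC -scalerA mono_gram scalerA mulrA mulVf ?mul1r.
Qed.

Let amono_isom s t : (amono s)^# \oc amono t = s^# \oc t.
Proof.
have [e1 _] := braid_unitary E a b; have [e2 _] := braid_unitary E b a.
rewrite /amono starZ !star_comp compZl compZr scalerA !compA.
rewrite (comp_chain2 _ e2) compm1 (comp_chain2 _ e1) compm1.
have -> : (wa * wb / wk)^* * (wa * wb / wk) = 1; last by rewrite scale1r.
have [ua ub] := (phase_unit Sa, phase_unit Sb).
have uk := phase_unit Sk.
have vk : wk^-1 = wk^* by apply: (mulfI wk0); rewrite mulfV.
by rewrite vk !rmorphM /= conjCK mulr_pairC ua ub uk !mul1r.
Qed.

(** The operator [amono] is unitary, and positive since it is represented by a
    Gram matrix; so it is the identity. *)
Let amono_id s : amono s = s.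
Proof.
have sadj u v : (amono u)^# \oc v = u^# \oc amono v.
  by rewrite -[_ \oc v]starK star_comp starK !amono_gram starZ star1 -gram_conj.
have inv u : amono (amono u) = u.
  apply/eqP; rewrite -subr_eq0; apply/eqP; set z := _ - _.
  apply: cstar_eq0; rewrite {2}/z compBr -sadj amono_isom.
  by rewrite subrr.
have addN u v : amono (u - v) = amono u - amono v.
  by rewrite /amono compBr scalerBr.
(* On the vector t = s - amono s, an eigenvector of eigenvalue -1, positivity
   forces t = 0. *)
pose t := s - amono s.
have tN : amono t = - t by rewrite /t addN inv opprB.
have tg := amono_gram t t; rewrite tN in tg.
have tp : t^# \oc t = (- gram t t) *: idm k.
  have cN : t^# \oc (- t) = - (t^# \oc t) by rewrite -[- t]sub0r compBr comp0r sub0r.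
  by rewrite scaleNr -tg cN opprK.
have g0 : gram t t = 0.
  apply/eqP; rewrite eq_le gram_pos andbT -oppr_ge0.
  exact: irr_pos (std_irr Sk) tp.
have /eqP : t = 0 by apply: cstar_eq0; rewrite tp g0 oppr0 scale0r.
by rewrite subr_eq0 => /eqP.
Qed.

(** The monodromy acts on [Hom(k, a b)] as a scalar. *)
Lemma mono_fus s x : mono a b x \oc fus s x = (wk / (wa * wb)) *: fus s x.
Proof.
have w0 (v : R[i]) : v * v^* = 1 -> v != 0.
  by move=> H; apply: contra_eq_neq H => ->; rewrite mul0r eq_sym oner_eq0.
rewrite -[in RHS](amono_id s) amonoE scalerA.
have [wa0 wb0] := (w0 _ (phase_unit Sa), w0 _ (phase_unit Sb)).
by rewrite mulr_inv_pair ?scale1r.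
Qed.

(** The double partial trace of a morphism that factors through [k]. *)
Lemma ltr2_fus s t x y (M : Hom (k \ox x) (k \ox y)) z : t^# \oc s = z *: idm k ->
  ltr rb (ltr ra (fus s y \oc M \oc (fus t x)^#)) = z *: ltr rk M.
Proof.
rewrite ltr2_gram -{1}(amono_id s) amono_gram.
by move=> /(scal_inj (std_irr Sk).1) ->.
Qed.

End Product.

(** * Decomposition into irreducible objects *)

Lemma eigenvector_exists (K : numClosedFieldType) (V : vectType K) (f : {linear V -> V})
    (U : {vspace V}) : U != 0%VS -> (forall u, u \in U -> f u \in U) ->
  exists a u, [/\ u \in U, u != 0 & f u = a *: u].
Proof.
move=> U0 fU; pose X := vbasis U.
have Ugt0 : (0 < \dim U)%N by rewrite lt0n dimv_eq0.
have [a /eigenvalueP[v vA v0]] :=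
  eigenvalue_closed (\matrix_(i < \dim U, j < \dim U) coord X j (f X`_i)) Ugt0.
have XU (i : 'I_(\dim U)) : X`_i \in U.
  by apply: vbasis_mem; apply: mem_nth; rewrite size_tuple.
have uU (c : 'I_(\dim U) -> K) : \sum_i c i *: X`_i \in U.
  by apply: rpred_sum => i _; apply: rpredZ.
exists a, (\sum_i v 0 i *: X`_i); split; first exact: uU.
  apply: contra_neq v0 => v0; apply/rowP => i; rewrite [RHS]mxE.
  have /freeP H : free X := basis_free (vbasisP U).
  exact: (H (fun i => v 0 i) v0 i).
rewrite linear_sum scaler_sumr /=.
transitivity (\sum_i v 0 i *: \sum_j coord X j (f X`_i) *: X`_j).
  by apply: eq_bigr => i _; rewrite linearZ /= {1}(coord_vbasis (fU _ (XU i))).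
transitivity (\sum_j (v *m \matrix_(i, j) coord X j (f X`_i)) 0 j *: X`_j); last first.
  by rewrite vA; apply: eq_bigr => j _; rewrite mxE scalerA.
under eq_bigr do rewrite scaler_sumr.
rewrite exchange_big; apply: eq_bigr => j _; rewrite mxE scaler_suml.
by apply: eq_bigr => i _; rewrite mxE scalerA.
Qed.

Section Composition.
Variables (R : realType) (C : cstar_category R).

(** Left composition, as a linear map. *)
Definition lcomp (a b c : C) (h : Hom b c) (f : Hom a b) : Hom a c := h \oc f.

Fact lcomp_linear a b c (h : Hom b c) : linear (@lcomp a b c h).
Proof. by move=> z f g; rewrite /lcomp compDr. Qed.

HB.instance Definition _ a b c (h : Hom b c) :=
  GRing.isLinear.Build R[i] (Hom a b) (Hom a c) _ (@lcomp a b c h) (@lcomp_linear a b c h).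

(** A nonzero endomorphism algebra contains a projection [e] with
    [e End(b) e = C e]: a right ideal of least dimension is generated by
    such an [e]. *)
Lemma minimal_projection (b : C) : idm b <> 0 ->
  exists e : Hom b b, [/\ projection e, e <> 0 &
    forall f : Hom b b, exists z, e \oc f \oc e = z *: e].
Proof.
move=> b0.
pose rideal (U : {vspace Hom b b}) := `[< forall x y : Hom b b, x \in U -> x \oc y \in U >].
have : exists n, `[< exists U : {vspace Hom b b}, [/\ U != 0%VS, rideal U & \dim U = n] >].
  exists (\dim {:Hom b b}); apply/asboolP; exists fullv; split=> //.
    apply/eqP => U0; apply: b0; apply/eqP.
    by rewrite -memv0 -U0 memvf.
  by apply/asboolP => x y _; rewrite memvf.
move=> ex; have [n /asboolP[U [U0 /asboolP rU dU]] nmin] := ex_minnP ex.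
(* U is a right ideal of least dimension n. *)
have sub_eq W : (W <= U)%VS -> W != 0%VS -> rideal W -> W = U.
  move=> WU W0 rW; apply/eqP; rewrite eqEdim WU /= dU.
  by apply: nmin; apply/asboolP; exists W.
(* By minimality, left composition with x vanishes on U as soon as it has a
   kernel there. *)
have ker_id (x : Hom b b) : (U :&: lker (linfun (lcomp (a := b) x)))%VS != 0%VS ->
    forall y, y \in U -> x \oc y = 0.
  move=> K0 y; rewrite -(sub_eq _ (capvSl _ _) K0); last first.
    apply/asboolP => u v; rewrite !memv_cap !memv_ker !lfunE /= /lcomp => /andP[uU /eqP xu].
    by rewrite rU //= compA xu comp0l.
  by rewrite memv_cap memv_ker lfunE => /andP[_ /eqP].
have [x xU x0] : exists2 x, x \in U & x != 0.
  by exists (vpick U); rewrite ?memv_pick ?vpick0.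
pose h := x \oc x^#.
have hU : h \in U by apply: rU.
have hs : h^# = h by rewrite star_comp starK.
have h0 : h <> 0 by move=> /cstar_eq0' /eqP; rewrite (negPf x0).
have hh0 : h \oc h <> 0 by rewrite -{1}hs => /cstar_eq0.
have kh : (U :&: lker (linfun (lcomp (a := b) h)))%VS = 0%VS.
  by apply/eqP; apply: contra_notT hh0 => /ker_id; apply.
(* Left composition with h is thus a bijection of U onto itself; the solution
   e of h e = h is the projection that is sought. *)
clearbody h.
have surj y : y \in U -> exists2 u, u \in U & h \oc u = y.
  have {1}-> : U = (linfun (lcomp (a := b) h) @: U)%VS.
    apply/esym/eqP; rewrite eqEdim limg_dim_eq // leqnn andbT.
    by apply/subvP => _ /memv_imgP[u uU ->]; rewrite lfunE /= rU.
  by move/memv_imgP => [u uU ->]; exists u; last by rewrite lfunE.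
have inj u : u \in U -> h \oc u = 0 -> u = 0.
  move=> uU hu; apply/eqP; rewrite -memv0 -kh memv_cap uU memv_ker lfunE /= /lcomp.
  exact/eqP.
have [e eU he] := surj _ hU; have [y yU hy] := surj _ eU.
have ee : e \oc e = e.
  apply/eqP; rewrite -subr_eq0; apply/eqP; apply: inj.
    by rewrite rpredB ?rU.
  by rewrite compBr compA !he subrr.
have es : e^# = e.
  suff E : e^# \oc e = e by rewrite -[in LHS]E star_comp starK E.
  by rewrite -[X in e^# \oc X]hy compA -{1}hs -star_comp he hs hy.
have e0 : e <> 0 by move=> e0; apply: h0; rewrite -he e0 comp0r.
exists e; split=> // f; pose g := e \oc f \oc e.
have [] := @eigenvector_exists _ _ (@lcomp b b b g) U U0.
  by move=> u uU; rewrite /= /lcomp /g -!compA; apply: rU.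
rewrite /= /lcomp => z [u [uU u0 gu]]; exists z.
have eu v : v \in U -> e \oc v = v.
  move=> vU; apply/eqP; rewrite -subr_eq0; apply/eqP; apply: inj.
    by rewrite rpredB // rU.
  by rewrite compBr compA he subrr.
(* The eigenvector u shows that e f e - z e has a kernel in U. *)
have K0 : (U :&: lker (linfun (lcomp (a := b) (g - z *: e))))%VS != 0%VS.
  apply: contra_neq u0 => K0; apply/eqP; rewrite -memv0 -K0 memv_cap uU memv_ker.
  by rewrite lfunE /= /lcomp compBl compZl (eu u uU) -gu subrr.
have := ker_id _ K0 _ eU; rewrite compBl compZl ee /g -compA ee => /eqP.
by rewrite subr_eq0 => /eqP.
Qed.

End Composition.

Section Decomposition.
Variables (R : realType) (C : unitary_fusion_category R).

Lemma irreducible_subobject (b : C) : idm b <> 0 ->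
  exists (c : C) (v : Hom c b), irreducible c /\ isometry v.
Proof.
move=> /minimal_projection[e [pe e0 emin]]; have [c [v [iv ve]]] := subobjects pe e0.
exists c, v; split=> //; split=> [c0|f].
  by apply: e0; rewrite -ve -[v]compm1 c0 comp0r comp0l.
have [z ez] := emin (v \oc f \oc v^#); exists z.
have := congr1 (fun x => v^# \oc x \oc v) ez; rewrite -ve /= compZr compZl.
by rewrite !compA iv !comp1m iv !comp1m (comp_chain2 _ iv) compm1 (comp_chain2 _ iv) compm1.
Qed.

End Decomposition.

Section Orthonormal.
Variables (R : realType) (C : cstar_category R).
Implicit Types a b c : C.

(** Orthonormal isometries with source [a]. *)
Definition orthonormal a b n (t : n.-tuple (Hom a b)) : Prop :=
  forall e e', (tnth t e)^# \oc tnth t e' = (e == e')%:R *: idm a.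

Lemma orthonormal_free a b n (t : n.-tuple (Hom a b)) :
  irreducible a -> orthonormal t -> free t.
Proof.
move=> [a0 _] ot; apply/freeP => k k0 j; apply: (scal_inj a0); rewrite scale0r.
have := congr1 (fun f => (tnth t j)^# \oc f) k0; rewrite /= comp0r comp_sumr => <-.
rewrite (bigD1 j) //= big1 ?addr0 => [|i ij]; rewrite compZr -tnth_nth ot ?eqxx ?scale1r //.
by rewrite eq_sym (negPf ij) scale0r scaler0.
Qed.

Lemma orthonormal_extend a b n (t : n.-tuple (Hom a b)) : irreducible a ->
  orthonormal t -> (n < \dim {:Hom a b})%N ->
  exists t' : n.+1.-tuple (Hom a b), orthonormal t'.
Proof.
move=> irr ot ltn.
have [v vt] : exists v, v \notin <<t>>%VS.
  apply: contrapT => H; move: ltn; rewrite ltnNge => /negP; apply.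
  have -> : {:Hom a b}%VS = <<t>>%VS.
    apply/eqP; rewrite eqEsubv subvf andbT; apply/subvP => v _.
    by apply/negPn/negP => vt; apply: H; exists v.
  by rewrite (leq_trans (dim_span t)) // size_tuple.
pose v' := v - \sum_e tnth t e \oc ((tnth t e)^# \oc v).
have tv' e : (tnth t e)^# \oc v' = 0.
  rewrite compBr comp_sumr (bigD1 e) //= big1 ?addr0 => [|i ie]; rewrite compA ot.
    by rewrite eqxx scale1r comp1m subrr.
  by rewrite eq_sym (negPf ie) scale0r comp0l.
have v'0 : v' <> 0.
  move/eqP; rewrite subr_eq0 => /eqP vE; move/negP: vt; apply; rewrite vE.
  apply: rpred_sum => e _; have [z ->] := irr.2 ((tnth t e)^# \oc v).
  by rewrite compZr compm1 rpredZ // memv_span // mem_tnth.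
have [mu muE] := irr.2 (v'^# \oc v').
have mu0 : 0 < mu by apply: (irr_gt0 irr muE).
pose s := (sqrtC mu)^-1 *: v'.
have ss : s^# \oc s = idm a.
  rewrite starZ compZl compZr muE !scalerA.
  rewrite geC0_conj ?invr_ge0 ?sqrtC_ge0 ?ltW // -mulrA -[X in _ * (_ * X)]sqrtCK.
  by rewrite expr2 mulKf ?mulVf ?scale1r // sqrtC_eq0 gt_eqF.
have ts e : (tnth t e)^# \oc s = 0 by rewrite compZr tv' scaler0.
have st e : s^# \oc tnth t e = 0 by apply: star_inj; rewrite star_comp starK star0.
exists [tuple of s :: t] => e e'.
case: (unliftP ord0 e) => [i|] ->; case: (unliftP ord0 e') => [j|] ->;
  rewrite ?tnth0 ?tnthS.
- by rewrite ot (inj_eq lift_inj).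
- by rewrite ts scale0r.
- by rewrite st scale0r.
- by rewrite ss scale1r.
Qed.

Lemma orthonormal_basis_exists a b : irreducible a ->
  exists t : (\dim {:Hom a b}).-tuple (Hom a b),
    basis_of {:Hom a b} t /\ orthonormal t.
Proof.
move=> irr.
have ext n : (n <= \dim {:Hom a b})%N -> exists t : n.-tuple (Hom a b), orthonormal t.
  elim: n => [_|n IHn ltn]; first by exists [tuple] => -[].
  have [t ot] := IHn (ltnW ltn).
  exact: (orthonormal_extend irr ot ltn).
have [t ot] := ext _ (leqnn _); exists t; split=> //.
by rewrite basisEfree (orthonormal_free irr ot) subvf size_tuple leqnn.
Qed.

Lemma orthonormal_expand a b n (t : n.-tuple (Hom a b)) (s : Hom a b) :
  basis_of {:Hom a b} t -> orthonormal t ->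
  \sum_e tnth t e \oc ((tnth t e)^# \oc s) = s.
Proof.
move=> bt ot; rewrite [in LHS](coord_basis bt (memvf s)) [RHS](coord_basis bt (memvf s)).
apply: eq_bigr => e _; rewrite comp_sumr (bigD1 e) //= big1 ?addr0 => [|i ie].
  by rewrite compZr -tnth_nth ot eqxx scale1r compZr compm1.
by rewrite compZr -tnth_nth ot eq_sym (negPf ie) scale0r scaler0.
Qed.

(** An injective map that is additive and linear up to an involution of the
    scalars does not lower dimensions. *)
Lemma dim_le_semilinear (K : fieldType) (V W : vectType K) (s : K -> K) (f : V -> W) :
  involutive s -> (forall u v, f (u + v) = f u + f v) ->
  (forall z v, f (z *: v) = s z *: f v) ->
  (forall v, f v = 0 -> v = 0) -> (\dim {:V} <= \dim {:W})%N.
Proof.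
move=> sK fD fZ finj.
have f0 : f 0 = 0 by apply: (addrI (f 0)); rewrite -fD !addr0.
have s0 (w : V) : w != 0 -> s 0 = 0.
  move=> w0; have /eqP := fZ 0 w; rewrite scale0r f0 eq_sym scaler_eq0 => /orP[/eqP //|/eqP].
  by move/finj/eqP; rewrite (negPf w0).
pose X := vbasis {:V}.
have frX : free [tuple of map f X].
  apply/freeP => k k0.
  suff k1 : \sum_i s (k i) *: X`_i = 0.
    have /freeP H : free X := basis_free (vbasisP fullv).
    move=> i; rewrite -[k i]sK (H _ k1); apply: (s0 X`_i).
    by apply: (free_not0 (basis_free (vbasisP fullv))); rewrite mem_nth // size_tuple.
  apply: finj; rewrite -k0 (big_morph f fD f0); apply: eq_bigr => i _.
  by rewrite fZ sK (nth_map 0) // size_tuple.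
by rewrite -[X in (X <= _)%N](size_tuple [tuple of map f X]) -(eqP frX) dimvS ?subvf.
Qed.

End Orthonormal.

(** * The modular data of a spectrum *)

Section SpectrumData.
Variables (R : realType) (C : unitary_fusion_category R) (E : braiding C) (D : spectrum C).
Local Notation n := (spec_n D).
Implicit Types i j k l m : 'I_n.+1.
Local Notation beta := (beta E).
Local Notation std := (std E).
Local Notation mono := (mono E).
Local Notation N := (fusion_mult (D := D)).
Local Notation d := (dimD (D := D)).
Local Notation w := (omega E (D := D)).

(** Schur's lemma: inequivalent irreducible objects have no nonzero morphism
    between them. *)
Lemma schur k l (f : Hom (D k) (D l)) : k != l -> f = 0.
Proof.
move=> kl; apply: contrapT => f0; move/eqP: kl; apply; apply: rep_inj.
have [ik il] := (@rep_irreducible _ _ D k, @rep_irreducible _ _ D l).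
have [z fz] := ik.2 (f^# \oc f); have [z' fz'] := il.2 (f \oc f^#).
have z0 : 0 < z by apply: (irr_gt0 ik fz).
have zz' : z = z'.
  have : z *: f = z' *: f by rewrite -{1}[f]compm1 -compZr -fz compA fz' compZl comp1m.
  move/eqP; rewrite -subr_eq0 -scalerBl scaler_eq0 => /orP[|/eqP //].
  by rewrite subr_eq0 => /eqP.
have sz : (sqrtC z)^-1^* * (sqrtC z)^-1 * z = 1.
  rewrite geC0_conj ?invr_ge0 ?sqrtC_ge0 ?ltW // -mulrA -[X in _ * (_ * X)]sqrtCK.
  by rewrite expr2 mulKf ?mulVf // sqrtC_eq0 gt_eqF.
exists ((sqrtC z)^-1 *: f); split; rewrite starZ compZl compZr scalerA.
  by rewrite fz scalerA sz scale1r.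
by rewrite fz' scalerA -zz' [X in X * z]mulrC sz scale1r.
Qed.

(** The completeness relation for the irreducible subobjects of an object. *)
Lemma completeness (X : C) (p : 'I_n.+1 -> nat) (t : forall k, (p k).-tuple (Hom (D k) X)) :
  (forall k, basis_of {:Hom (D k) X} (t k) /\ orthonormal (t k)) ->
  \sum_k \sum_e tnth (t k) e \oc (tnth (t k) e)^# = idm X.
Proof.
move=> ob; set q := \sum_k _; apply/eqP; rewrite eq_sym -subr_eq0; apply/eqP.
apply: contrapT => p0.
(* If q <> 1, then the range of 1 - q contains an irreducible subobject, but q
   acts as the identity on the morphisms from irreducible objects. *)
have qs k (s : Hom (D k) X) : q \oc s = s.
  rewrite comp_suml (bigD1 k) //= [X in _ + X]big1 ?addr0 => [|l lk].
    rewrite comp_suml -[RHS](orthonormal_expand _ (ob k).1 (ob k).2).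
    by apply: eq_bigr => e _; rewrite compA.
  rewrite comp_suml big1 // => e _; rewrite -compA [_^# \oc s]schur ?comp0r //.
  by rewrite eq_sym.
have qq : q \oc q = q.
  rewrite {2}/q comp_sumr; apply: eq_bigr => k _; rewrite comp_sumr.
  by apply: eq_bigr => e _; rewrite compA qs.
have qst : q^# = q.
  rewrite star_sum; apply: eq_bigr => k _; rewrite star_sum; apply: eq_bigr => e _.
  by rewrite star_comp starK.
have pp : projection (idm X - q).
  split; last by rewrite starB star1 qst.
  by rewrite compBl comp1m compBr compm1 qq subrr subr0.
have [b [v [iv vp]]] := subobjects pp p0.
have b0 : idm b <> 0.
  by move=> b0; apply: p0; rewrite -vp -[v]compm1 b0 comp0r comp0l.
have [c [u [ic iu]]] := irreducible_subobject b0.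
have [k [g [g1 g2]]] := @rep_surj _ _ D _ ic.
pose s := v \oc u \oc g^#.
have s0 : s = 0.
  have : (idm X - q) \oc s = 0 by rewrite compBl comp1m qs subrr.
  by rewrite -vp /s !compA (comp_chain2 _ iv) compm1.
have := ic.1; apply.
have -> : idm c = u^# \oc v^# \oc s \oc g.
  by rewrite /s !compA (comp_chain2 _ iv) compm1 iu comp1m g1.
by rewrite s0 comp0r comp0l.
Qed.

(** From here on, a choice of conjugates in the spectrum, with standard
    solutions. *)
Variables (bar : 'I_n.+1 -> 'I_n.+1)
  (r : forall i, Hom one (D (bar i) \ox D i)) (rb : forall i, Hom one (D i \ox D (bar i))).
Hypothesis S : forall i, std (r i) (rb i) (d i) (w i).
Hypothesis Sb : forall i, std (rb i) (r i) (d (bar i)) (w (bar i)).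

Lemma dimD_gt0 i : 0 < d i. Proof. exact: std_d0 (S i). Qed.

Lemma omega_unit i : w i * (w i)^* = 1. Proof. exact: phase_unit (S i). Qed.

Lemma omega_neq0 i : w i != 0.
Proof. by apply: contra_eq_neq (omega_unit i) => ->; rewrite mul0r eq_sym oner_eq0. Qed.

Lemma omega_bar i : w (bar i) = w i. Proof. exact: phase_conj (S i) (Sb i). Qed.

Lemma dimD_bar i : d (bar i) = d i.
Proof.
apply: (scal_inj (one_irreducible C).1).
by rewrite -(std_d (Sb i) one) -(std_db (S i) one).
Qed.

(** Composition with the braiding. *)
Lemma fusion_multC i j k : N i j k = N j i k.
Proof.
suff le a b : (N a b k <= N b a k)%N by apply/eqP; rewrite eqn_leq !le.
apply: (@dim_le_semilinear _ _ _ id (fun t => E (D a) (D b) \oc t)) => //.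
- by move=> u v; rewrite compDr1.
- by move=> z v; rewrite compZr.
- move=> v /(congr1 (fun t => (E (D a) (D b))^# \oc t)).
  by rewrite compA (braid_unitary E _ _).1 comp1m comp0r.
Qed.

(** Frobenius reciprocity; bending a strand and taking the adjoint is
    antilinear. *)
Lemma fusion_mult_bar i j k : N (bar i) j k = N i k j.
Proof.
have le (a a' b c : C) (p : Hom one (a' \ox a)) (q : Hom one (a \ox a')) :
    (forall x, (cup q (a \ox x))^# \oc (a |> cup p x) = idm (a \ox x)) ->
    (\dim {:Hom b (a \ox c)} <= \dim {:Hom c (a' \ox b)})%N.
  move=> H; apply: (@dim_le_semilinear _ _ _ (fun z : R[i] => z^*)
    (fun t : Hom b (a \ox c) => (a' |> t^#) \oc cup p c)) => //.
  - exact: conjCK.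
  - by move=> u v; rewrite starD tensmD1r compDl1.
  - by move=> z v; rewrite starZ tensmZr compZl.
  - move=> t /(congr1 (fun f => (cup q b)^# \oc (a |> f))).
    rewrite wcomp compA -cup_star_nat -compA H compm1 tensm0r comp0r => t0.
    by rewrite -[t]starK t0 star0.
apply/eqP; rewrite eqn_leq; apply/andP; split.
  exact: le (std_zig (Sb i)).
exact: le (std_zig (S i)).
Qed.

(** The completeness relation for a product, in front of [x]. *)
Lemma fus_completeness (a b : C) (p : 'I_n.+1 -> nat)
    (t : forall k, (p k).-tuple (Hom (D k) (a \ox b))) x :
  (forall k, basis_of {:Hom (D k) (a \ox b)} (t k) /\ orthonormal (t k)) ->
  \sum_k \sum_e fus (tnth (t k) e) x \oc (fus (tnth (t k) e) x)^# = idm (a \ox (b \ox x)).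
Proof.
move=> /completeness cp.
have -> : idm (a \ox (b \ox x)) = assocV a b x \oc (idm (a \ox b) \xm idm x) \oc (assocV a b x)^#.
  by rewrite tensm1 compm1 /assocV eqm_star eqmK.
rewrite -cp tensm_suml comp_sumr comp_suml; apply: eq_bigr => k _.
rewrite tensm_suml comp_sumr comp_suml; apply: eq_bigr => e _.
by rewrite fus.unlock star_comp wstarl wcompl !compA.
Qed.

Lemma ltr2_1 i j x : ltr (r j) (ltr (r i) (idm (D i \ox (D j \ox x)))) = (d i * d j) *: idm x.
Proof.
by rewrite (ltr1 (S i)) ltrZ (ltr1 (S j)) scalerA.
Qed.

(** The double partial trace of a morphism computed in the channels of [i]
    and [j]. *)
Lemma ltr2_channels i j x (p : 'I_n.+1 -> nat)
    (t : forall k, (p k).-tuple (Hom (D k) (D i \ox D j)))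
    (G : forall k, 'I_(p k) -> Hom (D k) (D i \ox D j))
    (F : Hom (D i \ox (D j \ox x)) (D i \ox (D j \ox x)))
    (M : forall k, Hom (D k \ox x) (D k \ox x)) (m z : 'I_n.+1 -> R[i]) :
  (forall k, basis_of {:Hom (D k) (D i \ox D j)} (t k) /\ orthonormal (t k)) ->
  (forall k e, F \oc fus (tnth (t k) e) x = fus (G k e) x \oc M k) ->
  (forall k, \sum_e (tnth (t k) e)^# \oc G k e = z k *: idm (D k)) ->
  (forall k, ltr (r k) (M k) = m k *: idm x) ->
  ltr (r j) (ltr (r i) F) = (\sum_k z k * m k) *: idm x.
Proof.
move=> ob FG Gz Mm; rewrite -[F]compm1 -(fus_completeness x ob) comp_sumr.
rewrite !ltr_sum scaler_suml; apply: eq_bigr => k _; rewrite comp_sumr !ltr_sum.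
have irr := @rep_irreducible _ _ D k.
pose c e := projT1 (cid (irr.2 ((tnth (t k) e)^# \oc G k e))).
have cE e : (tnth (t k) e)^# \oc G k e = c e *: idm (D k).
  exact: (projT2 (cid (irr.2 ((tnth (t k) e)^# \oc G k e)))).
have -> : z k = \sum_e c e.
  by apply: (scal_inj irr.1); rewrite -Gz scaler_suml; apply: eq_bigr => e _.
rewrite mulr_suml scaler_suml; apply: eq_bigr => e _.
by rewrite compA FG (ltr2_fus (S i) (S j) (S k) _ (cE e)) Mm scalerA.
Qed.

Lemma ltr2_id_channels i j x (F : Hom (D i \ox (D j \ox x)) (D i \ox (D j \ox x)))
    (M : forall k, Hom (D k \ox x) (D k \ox x)) (m : 'I_n.+1 -> R[i]) :
  (forall k (s : Hom (D k) (D i \ox D j)), F \oc fus s x = fus s x \oc M k) ->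
  (forall k, ltr (r k) (M k) = m k *: idm x) ->
  ltr (r j) (ltr (r i) F) = (\sum_k (N i j k)%:R * m k) *: idm x.
Proof.
move=> FM Mm.
have ob k := orthonormal_basis_exists (D i \ox D j) (@rep_irreducible _ _ D k).
pose t k := projT1 (cid (ob k)); have tP k := projT2 (cid (ob k)).
apply: (ltr2_channels tP (G := fun k e => tnth (t k) e) _ _ Mm) => [k e|k].
  exact: FM.
rewrite (eq_bigr (fun _ => idm (D k))) => [|e _].
  by rewrite sumr_const card_ord scaler_nat.
by rewrite (tP k).2 eqxx scale1r.
Qed.

Lemma ltr2_scal_channels i j x (F : Hom (D i \ox (D j \ox x)) (D i \ox (D j \ox x)))
    (c : 'I_n.+1 -> R[i]) :
  (forall k (s : Hom (D k) (D i \ox D j)), F \oc fus s x = c k *: fus s x) ->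
  ltr (r j) (ltr (r i) F) = (\sum_k (N i j k)%:R * (c k * d k)) *: idm x.
Proof.
move=> Fc; apply: (ltr2_id_channels (M := fun k => c k *: idm (D k \ox x))) => [k s|k].
  by rewrite Fc compZr compm1.
by rewrite ltrZ (ltr1 (S k)) scalerA.
Qed.

Lemma dimDM i j : d i * d j = \sum_k (N i j k)%:R * d k.
Proof.
apply: (scal_inj (one_irreducible C).1); rewrite -ltr2_1.
rewrite (ltr2_scal_channels (c := fun=> 1)) => [|k s]; last by rewrite comp1m scale1r.
by congr (_ *: _); apply: eq_bigr => k _; rewrite mul1r.
Qed.

(** The trace of the monodromy of [i] and [j]. *)
Definition mono_trace i j : R[i] := \sum_k (N i j k)%:R * (w k / (w i * w j) * d k).

Lemma ltr2_mono i j x :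
  ltr (r j) (ltr (r i) (mono (D i) (D j) x)) = mono_trace i j *: idm x.
Proof.
by apply: ltr2_scal_channels => k s; rewrite (mono_fus (S i) (S j) (S k)).
Qed.

Lemma istail_mono (a b : C) : istail (mono a b).
Proof.
move=> x y; rewrite !mono.unlock.
exact: (istail_comp (istail_beta E b a) (istail_beta E a b) x y).
Qed.

Lemma ltr_mono i j x :
  ltr (r i) (mono (D i) (D j) x) = (mono_trace i j / d j) *: idm (D j \ox x).
Proof.
have tc := istail_sub (D j) (istail_cup (r i)).
have [z zP] := istail_irr (std_irr (S j)) (istail_ltr tc tc (istail_mono (D i) (D j))).
rewrite zP; congr (_ *: _).
apply: (mulIf (lt0r_neq0 (dimD_gt0 j))); rewrite divfK ?(lt0r_neq0 (dimD_gt0 j)) //.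
apply: (scal_inj (one_irreducible C).1).
by rewrite -scalerA -(ltr1 (S j)) -ltrZ -zP ltr2_mono.
Qed.

(** The traces of the monodromy with [j] define a character of the fusion ring. *)
Lemma mono_trace_char i k j :
  mono_trace i j / d j * (mono_trace k j / d j)
  = \sum_l (N i k l)%:R * (mono_trace l j / d j).
Proof.
set a := D i; set b := D k; set c := D j.
pose x : C := one; pose Mo := (a |> beta c b x) \oc beta c a (b \ox x)
  \oc (beta a c (b \ox x) \oc (a |> beta b c x)).
have T1 : ltr (r k) (ltr (r i) Mo)
    = (mono_trace i j / d j * (mono_trace k j / d j)) *: idm (c \ox x).
  have -> : Mo = (a |> beta c b x) \oc mono a c (b \ox x) \oc (a |> beta b c x).
    by rewrite /Mo mono.unlock !compA.
  rewrite ltr_nat ltr_mono compZr compm1 compZl ltrZ.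
  have -> : beta c b x \oc beta b c x = mono b c x by rewrite mono.unlock.
  by rewrite ltr_mono scalerA.
apply: (scal_inj (irr_teno1 (@rep_irreducible _ _ D j)).1).
rewrite -T1; apply: (ltr2_id_channels (M := fun l => mono (D l) c x)) => [l s|l].
  rewrite /Mo -!compA (compA (beta a c _)) (hex_fusl E c s x) mono.unlock !compA.
  by rewrite (hex_fusr E c s x).
by rewrite ltr_mono.
Qed.

(** The key relation: both sides compute the trace of the braid on the strands
    [i], [i], [l] in which [l] runs around the two strands [i] and these cross
    each other once. *)
Lemma self_braiding_trace_sum i l (p : 'I_n.+1 -> nat)
    (t : forall k, (p k).-tuple (Hom (D k) (D i \ox D i))) (z : 'I_n.+1 -> R[i]) :
  (forall k, basis_of {:Hom (D k) (D i \ox D i)} (t k) /\ orthonormal (t k)) ->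
  (forall k, \sum_e (tnth (t k) e)^# \oc E (D i) (D i) \oc tnth (t k) e = z k *: idm (D k)) ->
  \sum_k z k * mono_trace k l
  = w i * \sum_s (N i l s)%:R * ((w s / (w i * w l)) ^+ 2 * d s).
Proof.
move=> ob tz; set a := D i; set c := D l; pose x : C := one.
pose Mo := (a |> beta c a x) \oc beta c a (a \ox x)
  \oc (beta a c (a \ox x) \oc (a |> beta a c x)).
(* In the channels of a a, the crossing gives z and the loop of c a monodromy. *)
have lhs : ltr (r i) (ltr (r i) (beta a a (c \ox x) \oc Mo))
    = (\sum_k z k * (mono_trace k l / d l)) *: idm (c \ox x).
  apply: (ltr2_channels ob (G := fun k e => E a a \oc tnth (t k) e)
    (M := fun k => mono (D k) c x)) => [k e|k|k].
  - set s := tnth _ _.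
    rewrite fus_braid /Mo -!compA; congr (_ \oc _).
    rewrite (compA (beta a c _)) (hex_fusl E c s x) mono.unlock !compA.
    by rewrite (hex_fusr E c s x).
  - by rewrite -tz; apply: eq_bigr => e _; rewrite compA.
  - by rewrite ltr_mono.
have yb1 := yang_baxter E c a a x.
have yb2 := yang_baxter E a c a x.
(* The braid relation s1 s2 s1 s1 s2 = s2 s2 s1 s2 s2. *)
have W : beta a a (c \ox x) \oc Mo
    = (a |> mono a c x) \oc beta a a (c \ox x) \oc (a |> mono a c x).
  rewrite /Mo mono.unlock !wcomp !compA -yb1.
  by rewrite -(compA (a |> beta c a x) _ (c |> _)) -(compA (a |> beta c a x)) -yb2 !compA.
have rhs : ltr (r l) (ltr (r i) (ltr (r i) (beta a a (c \ox x) \oc Mo)))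
    = (w i * \sum_s (N i l s)%:R * ((w s / (w i * w l)) ^+ 2 * d s)) *: idm x.
  rewrite W ltr_nat (std_w (S i)) compZr compm1 compZl !ltrZ -scalerA; congr (_ *: _).
  apply: ltr2_scal_channels => k s.
  rewrite -compA (mono_fus (S i) (S l) (S k)) compZr (mono_fus (S i) (S l) (S k)).
  by rewrite scalerA expr2.
apply: (scal_inj (one_irreducible C).1).
rewrite -rhs lhs ltrZ (ltr1 (S l)) scalerA mulr_suml; congr (_ *: _).
by apply: eq_bigr => k _; rewrite -!mulrA mulVf ?mulr1 // lt0r_neq0 // dimD_gt0.
Qed.

(** An object equivalent to the unit has trivial monodromies. *)
Lemma mono_unit (a b : C) x : uequiv b one -> mono a b x = idm (a \ox (b \ox x)).
Proof.
move=> [u [u1 u2]].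
have m1 : mono a one x = idm (a \ox (one \ox x)).
  apply: pack_inj; rewrite mono.unlock !beta.unlock /assocm /assocV !compA !packE.
  rewrite pack_braid1r pack_braid1l !ptens1m -pack_idtens; rewrite <- pack_comp.
  by rewrite comp1m.
have E1 : mono a one x \oc (a |> (u \xm idm x)) = (a |> (u \xm idm x)) \oc mono a b x.
  rewrite mono.unlock -compA beta_natr compA beta_natl.
  by rewrite compA.
have := congr1 (fun f => (a |> (u^# \xm idm x)) \oc f) E1.
rewrite m1 comp1m /= compA -wcomp -wcompl u1 !tensm1 comp1m => <-.
by [].
Qed.

(** Since [D ord0] is equivalent to its square, [d_0^2 = d_0]. *)
Lemma dimD0 : d ord0 = 1.
Proof.
have [u [u1 u2]] := rep_one D.
have le k : (N ord0 ord0 k <= \dim {:Hom (D k) (D ord0)})%N.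
  apply: (@dim_le_semilinear _ _ _ id
    (fun t : Hom (D k) (D ord0 \ox D ord0) => lunit (D ord0) \oc ((u \xm idm _) \oc t))) => //.
  - by move=> f g; rewrite !compDr1.
  - by move=> z f; rewrite !compZr.
  - move=> f /(congr1 (fun g => (u^# \xm idm _) \oc ((lunit (D ord0))^# \oc g))).
    rewrite !comp0r (compA (lunit _)^#) /lunit eqm_star eqmK comp1m.
    by rewrite compA -wcompl u1 tensm1 comp1m.
have le1 : (N ord0 ord0 ord0 <= 1)%N.
  apply: (leq_trans (le ord0)).
  have [_ irr] := @rep_irreducible _ _ D ord0.
  have : (fullv <= <[idm (D ord0)]>)%VS.
    by apply/subvP => f _; have [z ->] := irr f; rewrite rpredZ // memv_line.
  by move/dimvS/leq_trans; apply; rewrite dim_vline leq_b1.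
have N0 k : k != ord0 -> N ord0 ord0 k = 0%N.
  move=> k0; apply/eqP; rewrite -leqn0 (leq_trans (le k)) // leqn0 dimv_eq0 -subv0.
  by apply/subvP => f _; rewrite (schur f k0) mem0v.
have := dimDM ord0 ord0; rewrite (bigD1 ord0) //= big1 ?addr0 => [|k k0]; last first.
  by rewrite N0 // mul0r.
move/(mulIf (lt0r_neq0 (dimD_gt0 ord0))) => dN; have := dimD_gt0 ord0; rewrite dN.
by case: (N _ _ _) le1 => [|[|]] //; rewrite ltxx.
Qed.

Lemma mono_trace0 i : mono_trace i ord0 = d i.
Proof.
apply: (scal_inj (one_irreducible C).1).
by rewrite -ltr2_mono (mono_unit _ _ (rep_one D)) ltr2_1 dimD0 mulr1.
Qed.

End SpectrumData.

(** * Algebra of the modular data *)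

Section ModularAlgebra.
Variables (K : numClosedFieldType) (n : nat).
Implicit Types i j k l : 'I_n.+1.
Variables (N : 'I_n.+1 -> 'I_n.+1 -> 'I_n.+1 -> nat) (d w : 'I_n.+1 -> K).
Variable bar : 'I_n.+1 -> 'I_n.+1.

(** The traces of the monodromies, that is, the complex conjugates of the
    entries of the matrix [Y]. *)
Let X i j : K := \sum_k (N i j k)%:R * (w k / (w i * w j) * d k).

Hypothesis d_gt0 : forall i, 0 < d i.
Hypothesis w_unit : forall i, w i * (w i)^* = 1.
Hypothesis w_bar : forall i, w (bar i) = w i.
Hypothesis d_bar : forall i, d (bar i) = d i.
Hypothesis NC : forall i j k, N i j k = N j i k.
Hypothesis N_bar : forall i j k, N (bar i) j k = N i k j.
Hypothesis dM : forall i j, d i * d j = \sum_k (N i j k)%:R * d k.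
Hypothesis X_char : forall i k j,
  X i j / d j * (X k j / d j) = \sum_l (N i k l)%:R * (X l j / d j).
Hypothesis X0 : forall i, X i ord0 = d i.

Let d_neq0 i : d i != 0. Proof. exact: lt0r_neq0. Qed.

Let w_neq0 i : w i != 0.
Proof. by apply: contra_eq_neq (w_unit i) => ->; rewrite mul0r eq_sym oner_eq0. Qed.

Let d_conj i : (d i)^* = d i. Proof. by rewrite geC0_conj // ltW. Qed.

Let w_conj i : (w i)^* = (w i)^-1.
Proof. by apply: (mulfI (w_neq0 i)); rewrite w_unit mulfV. Qed.

Let X_sym i j : X i j = X j i.
Proof. by apply: eq_bigr => k _; rewrite NC [w i * _]mulrC. Qed.

(** The matrix of scalar products of the columns of [X]. *)
Let H i j : K := \sum_k (X k i)^* * X k j.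

Let H_conj i j : (H i j)^* = H j i.
Proof.
rewrite rmorph_sum; apply: eq_bigr => k _.
by rewrite rmorphM /= conjCK mulrC.
Qed.

(** The columns of [X] are eigenvectors of the fusion matrices, and the
    fusion matrix of the conjugate of [i] is the transpose of that of [i]. *)
Let H_eigen i k j : X i j / d j * H k j = (X (bar i) k / d k)^* * H k j.
Proof.
have eig a b c : X a c / d c * X b c = \sum_l (N a b l)%:R * X l c.
  apply: (mulIf (invr_neq0 (d_neq0 c))); rewrite -[LHS]mulrA X_char mulr_suml.
  by apply: eq_bigr => l _; rewrite mulrA.
rewrite !mulr_sumr.
under eq_bigr do rewrite mulrCA eig mulr_sumr.
rewrite exchange_big; apply: eq_bigr => l _ /=.
rewrite mulrA -rmorphM eig rmorph_sum mulr_suml; apply: eq_bigr => m _.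
by rewrite N_bar rmorphM rmorph_nat /=; ring.
Qed.

Let H_gt0 j : 0 < H j j.
Proof.
rewrite /H (bigD1 ord0) //= X_sym X0 d_conj ltr_pwDl ?mulr_gt0 //.
by apply: sumr_ge0 => k _; rewrite mulrC mul_conjC_ge0.
Qed.

Let X_bar i j : X (bar i) j = (X i j)^*.
Proof.
have /(mulIf (lt0r_neq0 (H_gt0 j))) E := H_eigen i j j.
apply: (mulIf (invr_neq0 (d_neq0 j))); apply: (can_inj (@conjCK K)).
by rewrite -E rmorphM /= conjCK fmorphV /= d_conj.
Qed.

(** The modularity hypothesis. *)
Hypothesis X_inj : forall v : 'I_n.+1 -> K,
  (forall i, \sum_j X i j * v j = 0) -> forall j, v j = 0.

(** Columns that are not orthogonal belong to the same character of the fusion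
    ring, so they are proportional, which the invertibility of [X] excludes. *)
Let H_orth i j : i != j -> H i j = 0.
Proof.
move=> ij; apply: contraNeq ij => Hij.
have prop k : X k j / d j = X k i / d i.
  apply: (mulIf Hij); rewrite H_eigen X_bar rmorphM /= conjCK fmorphV /= d_conj.
  by [].
case: eqVneq => // ij.
have := X_inj (v := fun l => (l == j)%:R / d j - (l == i)%:R / d i) _ i.
rewrite (negPf ij) eqxx mul0r sub0r mul1r => Z.
suff /eqP : - (d i)^-1 = 0 by rewrite oppr_eq0 invr_eq0 (negPf (d_neq0 i)).
apply: Z => k; under eq_bigr do rewrite mulrBr.
rewrite sumrB (bigD1 j) //= big1 => [|l /negPf ->]; last by rewrite mul0r mulr0.
rewrite [X in _ - X](bigD1 i) //= [X in _ - (_ + X)]big1 => [|l /negPf ->]; last first.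
  by rewrite mul0r mulr0.
by rewrite !eqxx !mul1r !addr0 prop subrr.
Qed.

Let dd : K := \sum_k d k ^+ 2.

Let dd_gt0 : 0 < dd.
Proof.
rewrite /dd (bigD1 ord0) //= ltr_pwDl ?exprn_gt0 //.
by apply: sumr_ge0 => k _; rewrite exprn_ge0 // ltW.
Qed.

(** All columns have the same norm: [H] is diagonal by [H_orth], and it commutes
    with the conjugate of [X], whose first row has no zero entry. *)
Let H_diag j : H j j = dd.
Proof.
have H0 : H ord0 ord0 = dd by apply: eq_bigr => k _; rewrite X0 d_conj expr2.
rewrite -H0; apply: (mulfI (d_neq0 j)).
(* The entry (ord0, j) of conj(X) X conj(X), computed in two ways. *)
have E1 : \sum_l H ord0 l * (X l j)^* = d j * H ord0 ord0.
  rewrite (bigD1 ord0) //= big1 => [|l l0]; last by rewrite H_orth ?mul0r // eq_sym.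
  by rewrite X_sym X0 d_conj addr0 mulrC.
rewrite -E1; under eq_bigr do rewrite mulr_suml.
rewrite exchange_big (bigD1 j) //= [X in _ + X]big1 => [|k kj].
  rewrite addr0 X0 d_conj -[H j j]H_conj rmorph_sum mulr_sumr.
  by apply: eq_bigr => k _; rewrite rmorphM /= conjCK [X k j]X_sym mulrA.
transitivity (d k * (H j k)); last by rewrite H_orth ?mulr0 // eq_sym.
rewrite X0 d_conj mulr_sumr; apply: eq_bigr => l _.
by rewrite -mulrA [X k l]X_sym [X l k * _]mulrC.
Qed.

Let HE i j : H i j = (i == j)%:R * dd.
Proof.
by case: eqVneq => [->|ij]; rewrite ?H_diag ?mul1r // H_orth ?mul0r.
Qed.

Let sigma : K := \sum_i d i ^+ 2 * (w i)^-1.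

(** Parseval's identity for [X], applied to the vector [d_j w_j], whose image
    is computed by the Gauss sum [sigma]. *)
Let sigma_norm : `|sigma| ^+ 2 = dd.
Proof.
have dsum i k : \sum_j (N i j k)%:R * d j = d i * d k.
  by rewrite -d_bar dM; apply: eq_bigr => j _; rewrite N_bar.
have gauss i : \sum_j X i j * (d j * w j) = d i / w i * sigma^*.
  under eq_bigr do rewrite mulr_suml.
  rewrite exchange_big /= rmorph_sum mulr_sumr; apply: eq_bigr => k _.
  rewrite rmorphM rmorphXn /= d_conj fmorphV /= w_conj invrK.
  transitivity (w k * d k / w i * \sum_j (N i j k)%:R * d j).
    rewrite mulr_sumr; apply: eq_bigr => j _.
    have -> : w k / (w i * w j) = w k / w i / w j by rewrite invfM mulrA.
    rewrite !mulrA; field.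
    by rewrite !w_neq0.
  rewrite dsum; field.
  exact: w_neq0.
apply: (mulfI (lt0r_neq0 dd_gt0)).
transitivity (\sum_i (\sum_j X i j * (d j * w j))^* * (\sum_j X i j * (d j * w j))).
  rewrite mulr_suml; apply: eq_bigr => i _; rewrite gauss !rmorphM /= conjCK normCK.
  rewrite fmorphV /= w_conj invrK d_conj.
  by field; apply: w_neq0.
transitivity (\sum_i \sum_j (d i * w i)^* * (d j * w j) * H i j).
  under eq_bigr do rewrite rmorph_sum mulr_suml.
  rewrite exchange_big; apply: eq_bigr => i _ /=.
  under eq_bigr do rewrite mulr_sumr.
  rewrite exchange_big; apply: eq_bigr => j _ /=.
  rewrite mulr_sumr; apply: eq_bigr => k _; rewrite !rmorphM /=.
  by ring.
rewrite mulr_suml; apply: eq_bigr => i _.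
rewrite (bigD1 i) //= big1 => [|j ji]; last by rewrite HE eq_sym (negPf ji) mul0r mulr0.
rewrite HE eqxx addr0 rmorphM /= d_conj mul1r -[_ * dd]mulrA mulrCA.
transitivity (d i * d i * (w i * (w i)^*) * dd); first by ring.
by rewrite w_unit mulr1 expr2.
Qed.

Let S : 'M[K]_n.+1 := \matrix_(i, j) (`|sigma|^-1 * (X i j)^*).

Let S_conj i j : (S i j)^* = `|sigma|^-1 * X i j.
Proof. by rewrite mxE rmorphM /= conjCK geC0_conj // invr_ge0. Qed.

(** Inversion of the key relation by the unitarity of [S]. *)
Lemma trace_inversion (i : 'I_n.+1) (tau : 'I_n.+1 -> K) :
  (forall l, \sum_k tau k * X k l
     = w i * \sum_s (N i l s)%:R * ((w s / (w i * w l)) ^+ 2 * d s)) ->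
  forall k, tau k = (w i)^-1 *
    \sum_r \sum_s (S r k)^* * S s ord0 * (N r s i)%:R * (w s ^+ 2 / w r ^+ 2).
Proof.
move=> tX k.
have Q r : \sum_s (N r s i)%:R * (w s ^+ 2 / w r ^+ 2) * d s
    = w i * \sum_l tau l * (X r l)^*.
  under [in RHS]eq_bigr do rewrite -X_bar X_sym.
  rewrite tX !mulr_sumr; apply: eq_bigr => s _.
  have -> : N i (bar r) s = N r s i by rewrite NC N_bar.
  rewrite w_bar; field.
  by rewrite !w_neq0.
have s2 : `|sigma|^-1 * `|sigma|^-1 = dd^-1 by rewrite -invfM -expr2 sigma_norm.
transitivity (dd^-1 * \sum_r X r k * \sum_l tau l * (X r l)^*).
  apply: (mulfI (lt0r_neq0 dd_gt0)); rewrite mulrA mulfV ?(lt0r_neq0 dd_gt0) // mul1r.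
  under eq_bigr do rewrite mulr_sumr.
  rewrite exchange_big (bigD1 k) //= [X in _ + X]big1 => [|l lk].
    rewrite addr0 -(H_diag k) mulr_suml; apply: eq_bigr => r _.
    by ring.
  transitivity (tau l * H l k); last by rewrite H_orth ?mulr0.
  by rewrite mulr_sumr; apply: eq_bigr => r _; ring.
rewrite -s2 !mulr_sumr; apply: eq_bigr => r _.
have := Q r => /(congr1 (fun z => (w i)^-1 * z)).
rewrite [in X in _ = X -> _]mulrA mulVf // mul1r.
move=> <-; rewrite !mulr_sumr; apply: eq_bigr => s _.
rewrite S_conj [S s ord0]mxE X0 d_conj.
by ring.
Qed.

End ModularAlgebra.

(** * The trace of the self-braiding *)

Section Main.
Variables (R : realType) (C : umtc R) (D : spectrum C).
Local Notation n := (spec_n D).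
Local Notation E := (umtc_braiding C).

(** The conjugate of [D i] can be chosen in the spectrum. *)
Lemma spectrum_conjugate (i : 'I_n.+1) :
  exists (j : 'I_n.+1) (r : Hom one (D j \ox D i)) (rb : Hom one (D i \ox D j)),
    std E r rb (dimD i) (omega E i) /\ std E rb r (dimD j) (omega E j).
Proof.
have irr := @rep_irreducible _ _ D i; have o1 := one_irreducible C.
have [ab [r [rb ss]]] := standard_exists o1 irr (conjugates (D i)).
have [j [u uu]] := @rep_surj _ _ D _ (irr_conj irr ss.1).
have ss' := standard_transport uu ss.
exists j, ((u \xm idm (D i)) \oc r), ((D i |> u) \oc rb); split.
  exact: std_qdim_phase.
apply: std_qdim_phase => //; last exact: standard_sym.
exact: rep_irreducible.
Qed.

(** The trace of the self-braiding is computed in some orthonormal basis. *)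
Lemma self_braiding_traceP (k i : 'I_n.+1) :
  exists t : (fusion_mult i i k).-tuple (Hom (D k) (D i \ox D i)),
    (basis_of {:Hom (D k) (D i \ox D i)} t /\ orthonormal t) /\
    \sum_e (tnth t e)^# \oc E (D i) (D i) \oc tnth t e
      = self_braiding_trace E k i *: idm (D k).
Proof.
have irr := @rep_irreducible _ _ D k.
have [t ot] := orthonormal_basis_exists (D i \ox D i) irr.
have [z zP] := irr.2 (\sum_e (tnth t e)^# \oc E (D i) (D i) \oc tnth t e).
rewrite /self_braiding_trace; case: xgetP => [y _ [t' [ot' yP]]|/(_ z)[]].
  by exists t'.
by exists t.
Qed.

(** Standard solutions for all the objects of the spectrum at once. *)
Lemma conjugate_solutions : exists (bar : 'I_n.+1 -> 'I_n.+1)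
  (r : forall i, Hom one (D (bar i) \ox D i)) (rb : forall i, Hom one (D i \ox D (bar i))),
  (forall i, std E (r i) (rb i) (dimD i) (omega E i)) /\
  (forall i, std E (rb i) (r i) (dimD (bar i)) (omega E (bar i))).
Proof.
exists (fun j => projT1 (cid (spectrum_conjugate j))).
exists (fun j => projT1 (cid (projT2 (cid (spectrum_conjugate j))))).
exists (fun j => projT1 (cid (projT2 (cid (projT2 (cid (spectrum_conjugate j))))))).
by split=> j; have [] := projT2 (cid (projT2 (cid (projT2 (cid (spectrum_conjugate j)))))).
Qed.

Lemma omega_conjV i : (omega E (D := D) i)^* = (omega E i)^-1.
Proof.
have [bar [r [rb [S _]]]] := conjugate_solutions.
by apply: (mulfI (omega_neq0 S i)); rewrite (omega_unit S) mulfV ?(omega_neq0 S).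
Qed.

Lemma dimD_conj i : (dimD (D := D) i)^* = dimD i.
Proof.
have [bar [r [rb [S _]]]] := conjugate_solutions.
by rewrite geC0_conj // ltW // (dimD_gt0 S).
Qed.

Lemma SmxE a b : Smx E D a b = `|sigma E D|^-1 * (mono_trace E a b)^*.
Proof.
rewrite !mxE; congr (_ * _).
rewrite rmorph_sum; apply: eq_bigr => l _.
rewrite !rmorphM /= rmorph_nat fmorphV rmorphM /= !omega_conjV dimD_conj invfM !invrK.
by rewrite -[LHS]mulrA [(omega E l)^-1 * _]mulrC.
Qed.

Lemma Smx_real a : (Smx E D a ord0)^* = Smx E D a ord0.
Proof.
have [bar [r [rb [S _]]]] := conjugate_solutions.
by rewrite SmxE (mono_trace0 S) dimD_conj rmorphM /= dimD_conj geC0_conj // invr_ge0.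
Qed.

Lemma self_braiding_trace_formula (i k : 'I_n.+1) :
  self_braiding_trace E k i = (omega E i)^-1 *
    \sum_r \sum_s (Smx E D r k)^* * Smx E D s ord0 * (fusion_mult r s i)%:R *
      (omega E s ^+ 2 / omega E r ^+ 2).
Proof.
have [bar [r [rb [S Sb]]]] := conjugate_solutions.
have Xinj (v : 'I_n.+1 -> R[i]) : (forall a, \sum_b mono_trace E a b * v b = 0) ->
    forall b, v b = 0.
  move=> v0; pose cv := \col_b (v b)^*.
  have cv0 : Smx E D *m cv = 0.
    apply/colP => a; rewrite !mxE.
    transitivity (`|sigma E D|^-1 * (\sum_b mono_trace E a b * v b)^*).
      rewrite rmorph_sum mulr_sumr; apply: eq_bigr => b _.
      by rewrite SmxE [cv b 0]mxE rmorphM /= mulrA.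
    by rewrite v0 rmorph0 mulr0.
  move=> b; have := mulKmx (umtc_modular D) cv; rewrite cv0 mulmx0 => /esym/colP/(_ b).
  by rewrite !mxE => /eqP; rewrite conjC_eq0 => /eqP.
have tP l := projT2 (cid (self_braiding_traceP l i)).
have key l := self_braiding_trace_sum S l (fun m => (tP m).1) (fun m => (tP m).2).
have := trace_inversion (dimD_gt0 S) (omega_unit S) (omega_bar S Sb) (dimD_bar S Sb)
  (fusion_multC E (D := D)) (fusion_mult_bar S Sb) (dimDM S) (mono_trace_char S)
  (mono_trace0 S) Xinj key k.
move=> ->; congr (_ * _); apply: eq_bigr => a _; apply: eq_bigr => b _.
by rewrite !SmxE !mxE.
Qed.

End Main.

Theorem proposition2p3 (R : realType) (C : umtc R) (D : spectrum C) :
  let S := Smx (umtc_braiding C) D in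
  let w := omega (umtc_braiding C) (D := D) in
  let N := fusion_mult (D := D) in
  let tau := self_braiding_trace (umtc_braiding C) (D := D) in
  let nu := FS_indicator (umtc_braiding C) (D := D) in
  (forall i k : 'I_(spec_n D).+1,
     tau k i = (w i)^-1 *
       \sum_r \sum_s (S r k)^* * S s ord0 * (N r s i)%:R * (w s ^+ 2 / w r ^+ 2))
  /\
  (forall i : 'I_(spec_n D).+1,
     nu i =
       \sum_r \sum_s S r ord0 * S s ord0 * (N r s i)%:R * (w r ^+ 2 / w s ^+ 2)).
Proof.
move=> S w N tau nu; have tauE := @self_braiding_trace_formula R C D.
split=> [i k|i]; first exact: tauE.
have w0 : omega (umtc_braiding C) i != 0.
  have [j [r [rb [Si _]]]] := spectrum_conjugate i.
  by apply: contra_eq_neq (phase_unit Si) => ->; rewrite mul0r eq_sym oner_eq0.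
have Sreal r : (S r ord0)^* = S r ord0 by exact: Smx_real.
rewrite /nu /FS_indicator [self_braiding_trace _ _ _]tauE mulrA mulfV // mul1r.
rewrite exchange_big; apply: eq_bigr => s _; apply: eq_bigr => r _.
by rewrite Sreal [S r ord0 * _]mulrC /N (fusion_multC (umtc_braiding C)).
Qed.
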